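(* Let $\alpha\in\mathbb{R}$ and $\beta\in\mathbb{R}\setminus\{0\}$, and let $T_{\alpha,\beta}:\mathbb{R}\to\mathbb{R}$, $T_{\alpha,\beta}(x)=\beta x+\alpha$. With $U_{T_{\alpha,\beta}}$, $S_c$, the constant $c_\beta$ and the probability measure $\mu_\beta$ as defined in the context, the following hold. (1) For $c\ge 0$: $U_{T_{\alpha,\beta}}\cap S_c\neq\emptyset$ if and only if $c\ge c_\beta$. (2) $U_{T_{\alpha,\beta}}\cap S_{c_\beta}=\{\mu_\beta\circ T_{\gamma,1}^{-1}:\gamma\in\mathbb{R}\}$. (3) For every $c>c_\beta$ and every $\mu\in U_{T_{\alpha,\beta}}\cap S_c$, $U_{T_{\alpha,\beta}}\cap S_c\neq\{\mu\circ T_{\gamma,1}^{-1}:\gamma\in\mathbb{R}\}$.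
   Context: $\mathbb{T}$ is the unit circle identified with $[0,1)$, with Lebesgue measure $\lambda_{\mathbb{T}}$. For $x\in\mathbb{R}$, $\langle x\rangle=x-\lfloor x\rfloor\in[0,1)$ is the fractional part, and $R:\mathbb{R}\to\mathbb{T}$, $R(x)=\langle x\rangle$. $\mathcal{P}(\mathbb{R})$ is the set of Borel probability measures on $\mathbb{R}$. For $\mu\in\mathcal{P}(\mathbb{R})$ and a continuous monotone map $T:\mathbb{R}\to\mathbb{R}$, $\mu\circ T^{-1}$ is the push-forward of $\mu$ under $T$, and $\langle\mu\rangle:=\mu\circ R^{-1}$, a probability measure on $\mathbb{T}$. A measure $\mu\in\mathcal{P}(\mathbb{R})$ is a circularly invariant uniformizable probability measure (CIUPM) for $T$ if $\langle\mu\rangle=\langle\mu\circ T^{-1}\rangle=\lambda_{\mathbb{T}}$; $U_T$ denotes the set of all CIUPMs for $T$ in $\mathcal{P}(\mathbb{R})$. $\operatorname{supp}\mu$ is the smallest closed subset of $\mathbb{R}$ of full $\mu$-measure, $\operatorname{diam}(A)=\sup_{x,y\in A}|x-y|$, and for real $c\ge0$, $S_c=\{\mu\in\mathcal{P}(\mathbb{R}):\operatorname{diam}(\operatorname{supp}\mu)=c\}$. $T_{\gamma,1}$ is the translation $x\mapsto x+\gamma$. For $\beta\in\mathbb{Q}\setminus\{0\}$, $(p_\beta,q_\beta)$ is the unique pair of coprime positive integers with $|\beta|=p_\beta/q_\beta$. For $\beta\ne0$, $$c_\beta=\begin{cases}1+\frac{1}{|\beta|}-\frac{1}{p_\beta}&\text{if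 }\beta\in\mathbb{Q},\\ 1+\frac1{|\beta|}&\text{if }\beta\in\mathbb{R}\setminus\mathbb{Q}.\end{cases}$$ $\mu_\beta$ is the probability measure on $\mathbb{R}$ with density $\rho_\beta$ (with respect to Lebesgue measure) given by: (i) if $\beta\in[1,+\infty)\setminus\mathbb{Q}$: $\rho_\beta(t)=\beta t$ for $t\in[0,\frac1\beta)$; $\rho_\beta(t)=1$ for $t\in[\frac1\beta,1)$; $\rho_\beta(t)=-\beta t+1+\beta$ for $t\in[1,1+\frac1\beta]$; $\rho_\beta(t)=0$ elsewhere. (ii) if $\beta\in[1,+\infty)\cap\mathbb{Q}$: $\rho_\beta(t)=\frac{j}{q_\beta}$ for $t\in\left[\frac{j-1}{p_\beta},\frac{j}{p_\beta}\right)\cup\left[1+\frac{q_\beta-j-1}{p_\beta},1+\frac{q_\beta-j}{p_\beta}\right)$, $j=1,\dots,q_\beta-1$; $\rho_\beta(t)=1$ for $t\in\left[\frac{q_\beta-1}{p_\beta},1\right)$; $\rho_\beta(t)=0$ elsewhere. (iii) if $\beta\in(0,1)$: $\rho_\beta(t)=\beta\,\rho_{1/\beta}(\beta t)$ for all $t\in\mathbb{R}$. (iv) if $\beta\in(-\infty,0)$: $\rho_\beta(t)=\rho_{-\beta}(t)$ for all $t\in\mathbb{R}$. *)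

(* Defs.v *)
From HB Require Import structures.
From mathcomp Require Import all_boot all_order all_algebra.
From mathcomp Require Import all_classical all_reals all_analysis.

Set Implicit Arguments.
Unset Strict Implicit.
Unset Printing Implicit Defensive.

Import Order.TTheory GRing.Theory Num.Theory.
Import numFieldNormedType.Exports.

Local Open Scope classical_set_scope.
Local Open Scope ring_scope.

Section ciupm.
Context {R : realType}.
Local Notation RR := (measurableTypeR R).
Implicit Types (m : set RR -> \bar R) (mu : probability RR R).
Implicit Types (A : set R) (T : R -> R) (x y c t alpha beta gamma : R).

(* Equality of Borel measures. Leibniz equality would also compare the
   meaningless values taken on non-measurable sets. *)
Definition eq_meas m1 m2 : Prop :=
  forall A : set RR, measurable A -> m1 A = m2 A.

Definition fracpart x : R := x - (Num.floor x)%:~R.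

(* The circle is identified with [0, 1[, and measures on it with the Borel
   measures on the real line concentrated on [0, 1[. *)
Definition lambda_circle : set RR -> \bar R :=
  fun A => lebesgue_measure (A `&` `[0, 1[).

Definition push m T : set RR -> \bar R := pushforward m (T : RR -> RR).

Definition wrap m : set RR -> \bar R := push m fracpart.

Definition CIUPM T : set (probability RR R) :=
  [set mu | eq_meas (wrap mu) lambda_circle /\
            eq_meas (wrap (push mu T)) lambda_circle].

(* As the line is second countable, this intersection is itself a closed set
   of full measure, hence the smallest one. *)
Definition supp mu : set R :=
  \bigcap_(C in [set C : set R | closed C /\ mu C = 1%E]) C.

Definition diam A : \bar R :=
  ereal_sup [set `|xy.1 - xy.2|%:E | xy in A `*` A].

Definition diam_class c : set (probability RR R) :=
  [set mu | diam (supp mu) = c%:E].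

Definition affine alpha beta : R -> R := fun x => beta * x + alpha.

Definition translation gamma : R -> R := fun x => x + gamma.

Definition translates m : set (probability RR R) :=
  [set nu | exists gamma, eq_meas nu (push m (translation gamma))].

(* Meaningful only when beta is rational and nonzero; the default value (1, 1)
   is taken otherwise. *)
Definition pq beta : nat * nat :=
  xget (1%N, 1%N) [set pq : nat * nat |
    [/\ (0 < pq.1)%N, (0 < pq.2)%N, coprime pq.1 pq.2 &
        `|beta| = pq.1%:R / pq.2%:R]].

Definition p_ beta : nat := (pq beta).1.
Definition q_ beta : nat := (pq beta).2.

Definition c_ beta : R :=
  if `[< rational beta >] then 1 + `|beta|^-1 - (p_ beta)%:R^-1
  else 1 + `|beta|^-1.

Definition rho_irr beta t : R :=
  if t \in `[0, beta^-1[ then beta * t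
  else if t \in `[beta^-1, 1[ then 1
  else if t \in `[1, 1 + beta^-1] then - beta * t + 1 + beta
  else 0.

(* For beta >= 1 the steps below are pairwise disjoint, so that the sum of
   indicators is the corresponding step function. *)
Definition rho_rat beta t : R :=
  let p : R := (p_ beta)%:R in
  let q : R := (q_ beta)%:R in
  \sum_(1 <= j < q_ beta)
     j%:R / q * \1_(`[(j%:R - 1) / p, j%:R / p[ `|`
                    `[1 + (q - j%:R - 1) / p, 1 + (q - j%:R) / p[) t
  + \1_(`[(q - 1) / p, 1[) t.

Definition rho_ge1 beta t : R :=
  if `[< rational beta >] then rho_rat beta t else rho_irr beta t.

Definition rho_pos beta t : R :=
  if 1 <= beta then rho_ge1 beta t else beta * rho_ge1 beta^-1 (beta * t).

Definition rho beta t : R :=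
  if beta < 0 then rho_pos (- beta) t else rho_pos beta t.

Definition mu_ beta : set RR -> \bar R :=
  fun A => (\int[lebesgue_measure]_(t in A) (rho beta t)%:E)%E.

End ciupm.

(* Main.v *)
(* Put a = 1 / |beta|. As uniformity on the circle is invariant under
   translations and reflections, a law mu belongs to U_T if and only if it is
   uniform both modulo 1 and modulo a. Let F be the distribution function of
   such a mu carried by [0, c], and
     K(t) = \sum_(j, k >= 0) F(t - j - k a)   (below, [potential a F]),
   so that F is recovered from K by two successive differences, with steps 1 and
   a. Uniformity modulo 1 and modulo a makes K(t) - K(t - a) and K(t) - K(t - 1)
   affine for large t, so that L(t) = K(t) - t^2 / (2a) - b t has both periods 1
   and a on [c - 1 - a, +oo[ for some b.
   - If a is irrational and c = 1 + a, then L is constant, equal to L(0) = 0, on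
     [0, +oo[, because Z + a Z is dense and K is monotone; F >= 0 near 0 and
     F <= 1 near c force b = 0.
   - If a = q / p and c = 1 + a - 1 / p, then L has period 1 / p on
     [- 1 / p, +oo[, and K = 0 on [- 1 / p, 0] gives both b and L.
   In both cases F is determined by a: up to translation there is at most one
   law of U_T carried by an interval of length c_beta. In particular none is
   carried by a shorter interval, as it could be translated within an interval of
   length c_beta.
   The density of mu_beta is in all cases a trapezoid evaluated at t or at a
   discretization of t; it is a difference of the form phi(t) - phi(t - 1) and of
   the form psi(t) - psi(t - a), whence mu_beta is in U_T by telescoping. Finally,
   for c > c_beta, the mixtures of mu_beta and of its translate by c - c_beta are
   in U_T, have a support of diameter c, and are not translates of each other. *)
Require Import Defs.
From HB Require Import structures.
From mathcomp Require Import all_boot all_order all_algebra.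
From mathcomp Require Import all_classical all_reals all_analysis.
From mathcomp Require Import measurable_realfun zify ring lra.

Set Implicit Arguments.
Unset Strict Implicit.
Unset Printing Implicit Defensive.

Import Order.TTheory GRing.Theory Num.Theory.
Import numFieldNormedType.Exports.

Local Open Scope classical_set_scope.
Local Open Scope ring_scope.

(** * Sums of a function along a backward arithmetic progression *)

Section lattice_sum.
Context {R : realType}.
Implicit Types (F G : R -> R) (h t : R).

(** The series over all k >= 0, cut off where t - k h becomes negative. For t < 0 < h the truncation
    is 0 and only the term F t is kept, which is 0 once F vanishes on the negative half-line. *)
Definition lattice_sum h F t : R :=
  \sum_(0 <= k < (Num.truncn (t / h)).+1) F (t - k%:R * h).

(** Two admissible cutoffs differ only by terms at nonpositive arguments. The free cutoff [n] gives
    sums at different points a common length. *)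
Lemma lattice_sumE h F t n : 0 < h -> (forall x, x <= 0 -> F x = 0) ->
  t <= n%:R * h -> lattice_sum h F t = \sum_(0 <= k < n) F (t - k%:R * h).
Proof.
move=> h0 F0 tn; rewrite /lattice_sum; set m := _.+1.
have tm : t <= m%:R * h.
  by rewrite -ler_pdivrMr// ltW// truncnS_gt.
have trunc (i j : nat) : t <= i%:R * h -> (i <= j)%N ->
    \sum_(0 <= k < j) F (t - k%:R * h) = \sum_(0 <= k < i) F (t - k%:R * h).
  move=> ti ij; rewrite (@big_cat_nat _ _ _ i)//= [X in _ + X]big_nat_cond.
  rewrite [X in _ + X]big1 ?addr0//.
  move=> k /andP[/andP[ik _] _]; rewrite F0// subr_le0 (le_trans ti)//.
  by rewrite ler_pM2r// ler_nat.
by case/orP: (leq_total m n) => /trunc -> //; exact/esym.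
Qed.

Lemma lattice_sum_le0 h F t : 0 < h -> (forall x, x <= 0 -> F x = 0) ->
  t <= 0 -> lattice_sum h F t = 0.
Proof.
by move=> h0 F0 t0; rewrite (@lattice_sumE _ _ _ 0)// ?mul0r// big_geq.
Qed.

Lemma lattice_sumS h F t : 0 < h -> (forall x, x <= 0 -> F x = 0) ->
  lattice_sum h F t = F t + lattice_sum h F (t - h).
Proof.
move=> h0 F0; set m := (Num.truncn (t / h)).+1.
have tm : t <= m%:R * h by rewrite -ler_pdivrMr// ltW// truncnS_gt.
rewrite (@lattice_sumE _ _ _ m.+1)//; last first.
  by rewrite (le_trans tm)// ler_pM2r// ler_nat.
rewrite (@lattice_sumE _ _ (t - h) m)//; last by move: tm h0; clear; lra.
rewrite big_nat_recl//= mul0r subr0; congr (_ + _).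
by apply: eq_bigr => k _; congr (F _); rewrite -natr1; ring.
Qed.

Lemma lattice_sum_nondecreasing h F : 0 < h ->
  (forall x, x <= 0 -> F x = 0) -> {homo F : x y / x <= y} ->
  {homo lattice_sum h F : x y / x <= y}.
Proof.
move=> h0 F0 Fnd x y xy; set m := (Num.truncn (y / h)).+1.
have ym : y <= m%:R * h by rewrite -ler_pdivrMr// ltW// truncnS_gt.
rewrite (@lattice_sumE _ _ _ m)// ?(le_trans xy)// (@lattice_sumE _ _ y m)//.
by apply: ler_sum => k _; apply: Fnd; rewrite lerB.
Qed.

Lemma lattice_sumD h F G t : lattice_sum h (fun x => F x + G x) t =
  lattice_sum h F t + lattice_sum h G t.
Proof. by rewrite /lattice_sum big_split. Qed.

Lemma lattice_sum_shift h F t d : 0 < h -> 0 <= d ->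
  (forall x, x <= 0 -> F x = 0) ->
  lattice_sum h (fun x => F (x - d)) t = lattice_sum h F (t - d).
Proof.
move=> h0 d0 F0; set m := (Num.truncn (t / h)).+1.
have tm : t <= m%:R * h by rewrite -ler_pdivrMr// ltW// truncnS_gt.
rewrite (@lattice_sumE _ _ t m)//; last by move=> x x0; apply: F0; lra.
rewrite (@lattice_sumE _ _ (t - d) m)//; last lra.
by apply: eq_bigr => k _; congr F; ring.
Qed.

End lattice_sum.

(** * Functions on a half-line with two periods or two constant increments *)

Section two_periods.
Context {R : realType}.
Implicit Types (L M : R -> R) (a t x : R).

Lemma iter_shift L t0 d A : 0 <= d -> (forall t, t0 <= t -> L (t + d) = L t + A) ->
  forall t n, t0 <= t -> L (t + n%:R * d) = L t + n%:R * A.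
Proof.
move=> d0 Ld t n t0t; elim: n => [|n ih]; first by rewrite !mul0r !addr0.
have -> : t + n.+1%:R * d = (t + n%:R * d) + d by rewrite -natr1; ring.
rewrite Ld ?ih; first by rewrite -natr1; ring.
by rewrite (le_trans t0t)// lerDl mulr_ge0.
Qed.

Lemma iter_period L t0 d : 0 <= d -> (forall t, t0 <= t -> L (t + d) = L t) ->
  forall t n, t0 <= t -> L (t + n%:R * d) = L t.
Proof.
move=> d0 Ld t n t0t; rewrite (@iter_shift L t0 d 0)// ?mulr0 ?addr0// => x /Ld ->.
by rewrite addr0.
Qed.

(** The periods hold only to the right of [t0], so negative multiples are not directly usable. With
    [m] and [n] written as differences of naturals, [t] and [x] are both pushed right to a common
    point. *)
Lemma two_periods L a t0 : 0 <= a ->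
  (forall t, t0 <= t -> L (t + a) = L t) ->
  (forall t, t0 <= t -> L (t + 1) = L t) ->
  forall t x (m n : int), t0 <= t -> t0 <= x -> x = t + m%:~R + n%:~R * a ->
  L x = L t.
Proof.
move=> a0 La L1.
have nonneg t i j : t0 <= t -> L (t + i%:R + j%:R * a) = L t.
  move=> t0t; rewrite (@iter_period L t0)//.
    by rewrite -[i%:R]mulr1 (@iter_period L t0).
  by rewrite (le_trans t0t)// lerDl.
have split_int (m : int) : exists i j : nat, m%:~R = i%:R - j%:R :> R.
  case: m => m; first by exists m, 0%N; rewrite subr0.
  by exists 0%N, m.+1; rewrite NegzE mulrNz sub0r.
move=> t x m n t0t t0x.
have [i [i' ->]] := split_int m; have [j [j' ->]] := split_int n => xE.
rewrite -(nonneg x i' j')// -(nonneg t i j)//; congr L; rewrite xE; ring.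
Qed.

(* [M (t0 + n a)] is computed with steps [a], and up to a bounded error with
   steps [1]. *)
Lemma increments_proportional M a t0 (A B C : R) : 0 <= a ->
  (forall t, t0 <= t -> M (t + a) = M t + A) ->
  (forall t, t0 <= t -> M (t + 1) = M t + B) ->
  (forall t, t0 <= t <= t0 + 1 -> `|M t| <= C) ->
  A = a * B.
Proof.
move=> a0 Ma M1 MC; apply/eqP; rewrite -subr_eq0; apply/negPn/negP => AaB.
(* The bound does not depend on [n], which is absurd for large [n] if A differs from a B. *)
have bnd n : n%:R * `|A - a * B| <= 2 * C + `|B|.
  have na0 : 0 <= n%:R * a by rewrite mulr_ge0.
  have /andP[] := truncn_itv na0; set m := Num.truncn _ => mna nam.
  pose th := n%:R * a - m%:R.
  have th01 : 0 <= th <= 1 by rewrite /th -natr1 in nam *; apply/andP; split; lra.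
  have Mth := @iter_shift M t0 1 B ler01 M1 (t0 + th) m.
  have Mna := @iter_shift M t0 a A a0 Ma t0 n.
  have := MC t0; have := MC (t0 + th).
  rewrite -normr_nat -normrM.
  have -> : n%:R * (A - a * B) = M (t0 + th) - M t0 - th * B.
    have thE : t0 + th + m%:R * 1 = t0 + n%:R * a by rewrite /th; ring.
    move: Mth; rewrite thE Mna// => /(_ ltac:(lra)) ME.
    have -> : M (t0 + th) = M t0 + n%:R * A - m%:R * B by rewrite ME; ring.
    by rewrite /th; ring.
  move=> /(_ ltac:(lra)) b1 /(_ ltac:(lra)) b2.
  rewrite (le_trans (ler_normB _ _))// lerD//.
    by rewrite (le_trans (ler_normB _ _))//; lra.
  by rewrite normrM ler_piMl// ger0_norm; lra.
have e0 : 0 < `|A - a * B| by rewrite normr_gt0.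
have := bnd (Num.truncn ((2 * C + `|B|) / `|A - a * B|)).+1.
by apply/negP; rewrite -ltNge -ltr_pdivrMr// truncnS_gt.
Qed.

End two_periods.

(** * Density of Z + a Z for irrational a *)

Section dense_group.
Context {R : realType}.
Variables (a : R) (aI : ~ rational a).

(** Halving: if 1 or a is not an integer multiple of a positive element x of the group, division by
    x yields a positive element at most x / 2. If both are multiples of x, then a is rational. *)
Let small (N : nat) : exists m n : int, 0 < m%:~R + n%:~R * a <= 2^-1 ^+ N.
Proof.
elim: N => [|N [m [n /andP[x0 xN]]]].
  by exists 1, 0; rewrite mul0r addr0 ltr01 expr0 lexx.
move: x0 xN; set x := _ + _ => x0 xN.
(* the remainder of a generator modulo [x], or its complement to [x] *)
have half (u v : int) : ~ (exists k : int, u%:~R + v%:~R * a = k%:~R * x) ->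
    exists m n : int, 0 < m%:~R + n%:~R * a <= 2^-1 ^+ N.+1.
  move=> nk; set g := u%:~R + v%:~R * a in nk.
  pose k := Num.floor (g / x); have /andP[] := floor_itv (g / x).
  rewrite -/k ler_pdivlMr// ltr_pdivrMr// intrD mulrDl mul1r => kg gk.
  have {}kg : k%:~R * x < g.
    by rewrite lt_neqAle kg andbT; apply/eqP => kgE; apply: nk; exists k.
  have [r2|r2] := lerP (g - k%:~R * x) (x / 2).
    exists (u - k * m), (v - k * n).
    rewrite !intrB !intrM; have -> : u%:~R - k%:~R * m%:~R +
      (v%:~R - k%:~R * n%:~R) * a = g - k%:~R * x by rewrite /g /x; ring.
    by rewrite exprS; apply/andP; split; lra.
  exists ((k + 1) * m - u), ((k + 1) * n - v).
  rewrite !intrB !intrM !intrD; have -> : (k%:~R + 1) * m%:~R - u%:~R +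
    ((k%:~R + 1) * n%:~R - v%:~R) * a = (k%:~R + 1) * x - g by rewrite /g /x; ring.
  by rewrite exprS; apply/andP; split; lra.
have [[k kE]|/half//] := pselect (exists k : int, 1%:~R + 0%:~R * a = k%:~R * x).
have [[l lE]|/half//] := pselect (exists k : int, 0%:~R + 1%:~R * a = k%:~R * x).
exfalso; apply: aI; exists (l%:~R / k%:~R) => //.
rewrite fmorph_div/= !ratr_int.
have k0 : k%:~R != 0 :> R.
  by apply/eqP => k0; move: kE; rewrite k0 !mul0r addr0 => /eqP; rewrite oner_eq0.
apply: (mulfI k0); rewrite [LHS]mulrC divfK//.
transitivity (l%:~R * (k%:~R * x)); first by rewrite -kE; ring.
by rewrite mulrCA -lE; ring.
Qed.

Lemma dense_irrational_group (x e : R) : 0 < e ->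
  exists m n : int, x < m%:~R + n%:~R * a < x + e.
Proof.
move=> e0.
have [N Ne] : exists N : nat, 2^-1 ^+ N < e.
  have h1 : `|2^-1 : R| < 1 by rewrite ger0_norm; lra.
  have [N _ /(_ N (leqnn N))/=] := cvgr0_norm_lt _ (cvg_expr h1) _ e0.
  by rewrite ger0_norm ?exprn_ge0 ?invr_ge0//; exists N.
have [m [n /andP[g0 gN]]] := small N; move: g0 gN; set g := _ + _ => g0 gN.
pose k := Num.floor (x / g); have /andP[] := floor_itv (x / g).
rewrite -/k ler_pdivlMr// ltr_pdivrMr// intrD mulrDl mul1r => kg gk.
exists ((k + 1) * m), ((k + 1) * n).
rewrite !intrM !intrD; have -> : (k%:~R + 1) * m%:~R + (k%:~R + 1) * n%:~R * a =
  (k%:~R + 1) * g by rewrite /g; ring.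
apply/andP; split; lra.
Qed.

End dense_group.

(** * Reduced fractions *)

Section fraction.
Context {R : realType}.
Implicit Types beta : R.

(** The absolute values of the numerator and denominator belong to the set in [pq], so the default
    value is not taken. *)
Lemma pqP beta : rational beta -> beta != 0 ->
  [/\ (0 < p_ beta)%N, (0 < q_ beta)%N, coprime (p_ beta) (q_ beta) &
      `|beta| = (p_ beta)%:R / (q_ beta)%:R].
Proof.
move=> [r _ <-{beta}]; rewrite fmorph_eq0 => r0; rewrite /p_ /q_ /pq.
case: xgetP => [[p q] -> []//|/(_ (`|numq r|%N, `|denq r|%N))].
case; split => /=.
- by rewrite absz_gt0 numq_eq0.
- by rewrite absz_gt0.
- exact: coprime_num_den.
rewrite -{1}(divq_num_den r) fmorph_div/= !ratr_int normf_div.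
by rewrite !natr_absz !intr_norm.
Qed.

Lemma pq_rational beta : rational beta -> 0 < beta ->
  [/\ (0 < p_ beta)%N, (0 < q_ beta)%N, coprime (p_ beta) (q_ beta) &
      beta = (p_ beta)%:R / (q_ beta)%:R].
Proof.
move=> bQ b0; have [p0 q0 pq] := pqP bQ (lt0r_neq0 b0).
by rewrite gtr0_norm.
Qed.

End fraction.

(** * The potential and the uniqueness of the distribution function *)

Section rigidity.
Context {R : realType}.
Implicit Types (F G : R -> R) (a c t : R).

(* The conditions satisfied by the cumulative distribution function of a random
   variable with values in [0, c] that is uniform both modulo 1 and modulo a. *)
Definition uniform_cdf a c F : Prop :=
  [/\ {homo F : x y / x <= y}, forall t, t <= 0 -> F t = 0, forall t, F t <= 1,
      exists C, forall t, c - 1 <= t -> lattice_sum 1 F t = t + C &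
      exists C, forall t, c - a <= t -> lattice_sum a F t = t / a + C].

Definition potential a F : R -> R := lattice_sum a (lattice_sum 1 F).

Section potential.
Variables (a : R) (a0 : 0 < a) (F : R -> R).
Hypothesis F0 : forall t, t <= 0 -> F t = 0.

Let E0 t : t <= 0 -> lattice_sum 1 F t = 0.
Proof. exact: lattice_sum_le0. Qed.

Lemma potential_le0 t : t <= 0 -> potential a F t = 0.
Proof. exact: lattice_sum_le0. Qed.

Lemma potentialSa t :
  potential a F t = lattice_sum 1 F t + potential a F (t - a).
Proof. exact: lattice_sumS. Qed.

(** The step 1 is in the inner sum: one term is split off there, and the outer sum is additive and
    commutes with the shift by 1. *)
Lemma potentialS1 t :
  potential a F t = lattice_sum a F t + potential a F (t - 1).
Proof.
rewrite /potential -lattice_sum_shift// -lattice_sumD; congr lattice_sum.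
by apply/funext => x; rewrite {1}lattice_sumS.
Qed.

Lemma potential_differences t : F t = potential a F t - potential a F (t - a)
  - (potential a F (t - 1) - potential a F (t - 1 - a)).
Proof.
rewrite (potentialSa t) (potentialSa (t - 1)) (lattice_sumS t ltr01 F0); ring.
Qed.

End potential.

(** Without its quadratic part, the potential has constant increments over the steps a and 1, with a
    priori unrelated constants. They are proportional to the steps by [increments_proportional], so
    one linear term absorbs both. *)
Lemma uniform_cdf_periods a c F : 0 < a -> uniform_cdf a c F ->
  exists b, forall t, c - 1 - a <= t ->
    let L x := potential a F x - x ^+ 2 / (2 * a) - b * x in
    L (t + a) = L t /\ L (t + 1) = L t.
Proof.
move=> a0 [Fnd F0 F1 [C1 E1] [C2 Ea]].
pose M x := potential a F x - x ^+ 2 / (2 * a).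
have Ma t : c - 1 - a <= t -> M (t + a) = M t + (C1 + a / 2).
  move=> ct; rewrite /M potentialSa// addrK E1; last lra.
  by field; rewrite gt_eqF.
have M1 t : c - 1 - a <= t -> M (t + 1) = M t + (C2 + (2 * a)^-1).
  move=> ct; rewrite /M potentialS1// addrK Ea; last lra.
  by field; rewrite gt_eqF.
have Knd : {homo potential a F : x y / x <= y}.
  apply: lattice_sum_nondecreasing => // [x|]; first exact: lattice_sum_le0.
  exact: lattice_sum_nondecreasing.
set t0 := c - 1 - a in Ma M1 *.
have AB : C1 + a / 2 = a * (C2 + (2 * a)^-1).
  (* On [t0, t0 + 1], [q] bounds the quadratic part, and monotonicity bounds the potential by its
     values at the two ends. *)
  pose q := ((`|t0| + 1) ^+ 2) / (2 * a).
  apply: (@increments_proportional R M a t0 _ _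
    (`|potential a F t0| + `|potential a F (t0 + 1)| + q)) => //; first exact: ltW.
  move=> t /andP[t0t tt0]; rewrite /M (le_trans (ler_normB _ _))// lerD//.
    have := Knd _ _ t0t; have := Knd _ _ tt0.
    have := ler_norm (potential a F (t0 + 1)); have := ler_norm (- potential a F t0).
    have := normr_ge0 (potential a F (t0 + 1)); have := normr_ge0 (potential a F t0).
    by rewrite normrN ler_norml => *; apply/andP; split; lra.
  rewrite ger0_norm ?divr_ge0 ?sqr_ge0 ?mulr_ge0// ?(ltW a0)//.
  rewrite /q ler_pM2r ?invr_gt0 ?mulr_gt0// -[t ^+ 2]ger0_norm ?sqr_ge0//.
  rewrite normrX ler_pXn2r// ?nnegrE ?addr_ge0//.
  have := ler_normD t0 (t - t0); rewrite [t0 + _]addrC subrK.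
  by move=> /le_trans; apply; rewrite lerD2l ger0_norm; lra.
exists (C2 + (2 * a)^-1) => t t0t /=.
have := Ma _ t0t; have := M1 _ t0t; rewrite /M => -> ->; rewrite AB.
by split; ring.
Qed.

Lemma uniform_cdf_irrational a F t : 0 < a -> ~ rational a ->
  uniform_cdf a (1 + a) F -> 0 <= t -> potential a F t = t ^+ 2 / (2 * a).
Proof.
move=> a0 aI uF; have [Fnd F0 F1 _ _] := uF.
have [b /=] := uniform_cdf_periods a0 uF.
set L := fun x => potential a F x - x ^+ 2 / (2 * a) - b * x.
have -> : 1 + a - 1 - a = 0 by ring.
move=> perL.
have Knd : {homo potential a F : x y / x <= y}.
  apply: lattice_sum_nondecreasing => // [x|]; first exact: lattice_sum_le0.
  exact: lattice_sum_nondecreasing.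
(* Used in both directions. Monotonicity of the potential K stands in for continuity: a point y + d
   of the orbit of [x] lies just right of [y], where K(y + d) >= K(y) and the polynomial part of [L]
   has grown by at most d C. *)
have Lle x y : 0 <= x -> 0 <= y -> L y <= L x.
  move=> x0 y0; apply/ler_addgt0Pr => e e0.
  (* Bounds the growth rate of the polynomial part on [y, y + 1]; the last summand makes it
     positive. *)
  pose C := (2 * y + 1) / (2 * a) + `|b| + 1.
  have C1 : 0 <= (2 * y + 1) / (2 * a) by rewrite divr_ge0//; lra.
  have C0 : 0 < C by rewrite /C ltr_wpDl// addr_ge0.
  have d0 : 0 < Order.min 1 (e / C) by rewrite lt_min ltr01/= divr_gt0.
  have [m [n /andP[]]] := dense_irrational_group aI (y - x) d0.
  set g := _%:~R + _ => g1 g2.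
  have yz : y <= x + g by lra.
  have <- : L (x + g) = L x.
    apply: (@two_periods _ L a 0 (ltW a0) _ _ x (x + g) m n) => //;
      first by move=> z /perL[].
    - by move=> z /perL[].
    - lra.
    - by rewrite addrA.
  pose d := x + g - y.
  have xgE : x + g = y + d by rewrite /d; ring.
  have d00 : 0 <= d by rewrite /d; lra.
  have [d1 dC] : d <= 1 /\ d * C <= e.
    have : d <= Order.min 1 (e / C) by rewrite /d; lra.
    by rewrite le_min ler_pdivlMr// => /andP[].
  rewrite xgE /L; have := Knd _ _ yz; rewrite xgE => Kyd.
  have -> : (y + d) ^+ 2 / (2 * a) = y ^+ 2 / (2 * a) + d * ((2 * y + d) / (2 * a)).
    by field; rewrite gt_eqF.
  have : d * ((2 * y + d) / (2 * a)) <= d * ((2 * y + 1) / (2 * a)).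
    by rewrite ler_wpM2l// ler_pM2r ?invr_gt0 ?mulr_gt0//; lra.
  have : d * b <= d * `|b| by rewrite ler_wpM2l// ler_norm.
  move: dC d00 Kyd; rewrite /C; clearbody d; clear.
  move: (potential a F (y + d)) (potential a F y) ((2 * y + 1) / (2 * a))
    ((2 * y + d) / (2 * a)) (y ^+ 2 / (2 * a)) (`|b|) => *; lra.
have LE x : 0 <= x -> potential a F x = x ^+ 2 / (2 * a) + b * x.
  move=> x0; have : L x = 0.
    have -> : 0 = L 0 by rewrite /L potential_le0//; ring.
    by apply/eqP; rewrite eq_le !Lle.
  by rewrite /L; lra.
have K0 x : x <= 0 -> potential a F x = 0 by exact: potential_le0.
(* At [e] only one of the four values of the potential is nonzero, and F(e) >= 0 bounds [b] below.
   At 1 + a - e only the fourth vanishes, and F <= 1 bounds [b] above. *)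
have small e : 0 < e -> e < 1 -> e < a ->
    - (e / (2 * a)) <= b /\ b <= e / (2 * a).
  move=> e0 e1 ea; split.
    have : 0 <= F e by rewrite -(F0 0)// Fnd// ltW.
    rewrite (@potential_differences a a0 F F0 e) LE ?(ltW e0)//.
    rewrite (K0 (e - a)) ?(K0 (e - 1)) ?(K0 (e - 1 - a)); try lra.
    have -> : e ^+ 2 / (2 * a) + b * e - 0 - (0 - 0) = e * (e / (2 * a) + b).
      by field; rewrite gt_eqF.
    by rewrite pmulr_rge0//; lra.
  have := F1 (1 + a - e).
  rewrite (@potential_differences a a0 F F0 (1 + a - e)).
  rewrite [potential _ _ (1 + a - e)]LE; last lra.
  rewrite [potential _ _ (1 + a - e - a)]LE; last lra.
  rewrite [potential _ _ (1 + a - e - 1)]LE; last lra.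
  rewrite [potential _ _ (1 + a - e - 1 - a)]K0; last lra.
  set lhs := (X in X <= 1).
  have -> : lhs = 1 + e * (b - e / (2 * a)) by rewrite /lhs; field; rewrite gt_eqF.
  by rewrite gerDl pmulr_rle0//; lra.
have b0 : b = 0.
  apply/eqP/negPn/negP => bN0; have b0 : 0 < `|b| by rewrite normr_gt0.
  (* Small enough for [small] to apply and for e / (2 a) <= |b| / 4. *)
  pose e := Order.min (Order.min 1 a) (a * `|b|) / 2.
  have : 0 < e by rewrite /e divr_gt0// !lt_min ltr01 a0 mulr_gt0.
  have [] : e <= 1 / 2 /\ e <= a / 2 /\ e <= (a * `|b|) / 2.
    by rewrite /e !ler_pM2r ?invr_gt0// !ge_min !lexx ?orbT.
  move=> e1 [e2 e3] e0; have [] := small e e0 ltac:(lra) ltac:(lra).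
  have : e / (2 * a) <= `|b| / 4.
    rewrite ler_pdivrMr ?mulr_gt0//; lra.
  case: ler0P bN0 => [? /negP bN0 *|*]; last lra.
  by apply: bN0; apply/eqP; lra.
by move=> /LE ->; rewrite b0 mul0r addr0.
Qed.

(** By Bezout, 1 / p is an integer combination of 1 and q / p, whence the period 1 / p of [L]. The
    point [u] represents [t] modulo 1 / p in [- 1 / p, 0[, where the potential vanishes and [L] is
    explicit. *)
Lemma uniform_cdf_rational (p q : nat) F t : (0 < p)%N -> (0 < q)%N ->
  coprime p q -> let a : R := q%:R / p%:R in
  uniform_cdf a (1 + a - p%:R^-1) F -> 0 <= t ->
  let u := t - (Num.floor (p%:R * t) + 1)%:~R / p%:R in
  potential a F t = (t ^+ 2 - u ^+ 2) / (2 * a) + (2 * q%:R)^-1 * (t - u).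
Proof.
move=> p0 q0 pq a uF t0 u.
have p0R : 0 < p%:R :> R by rewrite ltr0n.
have q0R : 0 < q%:R :> R by rewrite ltr0n.
have a0 : 0 < a by rewrite divr_gt0.
have pi0 : 0 < p%:R^-1 :> R by rewrite invr_gt0.
have [Fnd F0 F1 _ _] := uF.
have [b /=] := uniform_cdf_periods a0 uF.
pose L x := potential a F x - x ^+ 2 / (2 * a) - b * x.
have -> : 1 + a - p%:R^-1 - 1 - a = - p%:R^-1 by ring.
move=> perL.
have [m [n mn]] : exists m n : int, m%:~R * p%:R + n%:~R * q%:R = 1 :> R.
  have [m [n mn]] := Bezoutz p q.
  have {}mn : m * p%:Z + n * q%:Z = 1 by rewrite mn /gcdz/=; congr Posz; exact/eqP.
  exists m, n; transitivity ((m * p%:Z + n * q%:Z)%:~R : R); last by rewrite mn.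
  by rewrite intrD !intrM.
have Lper x (j : int) : - p%:R^-1 <= x -> - p%:R^-1 <= x + j%:~R / p%:R ->
    L (x + j%:~R / p%:R) = L x.
  move=> x0 xj.
  apply: (@two_periods _ L a (- p%:R^-1) (ltW a0) _ _ x _ (j * m) (j * n)) => //.
  - by move=> y /perL[].
  - by move=> y /perL[].
  rewrite !intrM -addrA; congr (_ + _).
  transitivity (j%:~R * (m%:~R * p%:R + n%:~R * q%:R) / p%:R : R).
    by rewrite mn mulr1.
  by rewrite /a; field; rewrite gt_eqF.
have K0 x : x <= 0 -> potential a F x = 0 by exact: potential_le0.
(* From L(- 1 / p) = L(0), the potential being 0 at both points. *)
have bE : b = (2 * q%:R)^-1.
  have := Lper (- p%:R^-1) 1; rewrite mul1r addNr lexx /L K0// K0; last lra.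
  rewrite -[- p%:R^-1 <= 0]/(_ <= _) oppr_le0 ltW// => /(_ isT isT).
  rewrite expr0n/= mul0r mulr0 !subr0 /a => h.
  apply: (mulfI (lt0r_neq0 pi0)).
  transitivity ((- p%:R^-1) ^+ 2 / (2 * (q%:R / p%:R)) : R); first lra.
  by field; rewrite !gt_eqF.
have /andP[] := floor_itv (p%:R * t); set k := Num.floor _ => kt tk.
have [u1 u0] : - p%:R^-1 <= u /\ u <= 0.
  have : k%:~R / p%:R <= t by rewrite ler_pdivrMr// mulrC.
  have : t <= (k + 1)%:~R / p%:R by rewrite ler_pdivlMr// mulrC ltW.
  by rewrite /u -/k intrD mulrDl mul1r; split; lra.
have tE : t = u + (k + 1)%:~R / p%:R by rewrite /u -/k; ring.
have := Lper u (k + 1) u1; rewrite -tE => /(_ ltac:(lra)); rewrite /L (K0 u)// => KE.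
rewrite -bE mulrBr mulrBl; move: KE; clear; lra.
Qed.

Lemma uniform_cdf_unique beta F G t : 0 < beta ->
  uniform_cdf beta^-1 (c_ beta) F -> uniform_cdf beta^-1 (c_ beta) G -> F t = G t.
Proof.
move=> beta0 uF uG; have a0 : 0 < beta^-1 by rewrite invr_gt0.
have KE x : 0 <= x -> potential beta^-1 F x = potential beta^-1 G x.
  move: uF uG; rewrite /c_ (gtr0_norm beta0).
  case: asboolP => [betaQ|betaI] uF uG x0; last first.
    have aI : ~ rational beta^-1.
      apply: contra_not betaI => -[r _ rE]; exists r^-1 => //.
      by rewrite fmorphV/= rE invrK.
    by rewrite !uniform_cdf_irrational.
  have [p0 q0 pq bE] := pq_rational betaQ beta0.
  have binvE : beta^-1 = (q_ beta)%:R / (p_ beta)%:R by rewrite {1}bE invf_div.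
  by move: uF uG; rewrite binvE => uF uG; rewrite !uniform_cdf_rational.
have [_ F0 _ _ _] := uF; have [_ G0 _ _ _] := uG.
have {}KE x : potential beta^-1 F x = potential beta^-1 G x.
  by have [/KE->//|/ltW x0] := leP 0 x; rewrite !potential_le0.
by rewrite (potential_differences a0 F0) (potential_differences a0 G0) !KE.
Qed.

End rigidity.

(** * The density as a trapezoid, possibly sampled on a grid *)

Section density.
Context {R : realType}.
Implicit Types (a b beta t x : R).

Definition clip b x : R := Num.max 0 (Num.min x b).

(** For beta > 0, the difference is the length of [0, 1] between x - 1 / beta and x. This is thus
    the density of the sum of two independent variables, uniform on [0, 1] and on [0, 1 / beta]. *)
Definition trapezoid beta x : R := beta * (clip 1 x - clip 1 (x - beta^-1)).

(* When beta = p / q the density is the trapezoid sampled at the right end of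
   the cell of the grid of step 1 / p. *)
Definition cell_end beta t : R :=
  if `[< rational beta >]
  then (Num.floor ((p_ beta)%:R * t) + 1)%:~R / (p_ beta)%:R else t.

(** Commutativity of the convolution of the two intervals; it turns a difference of step 1 / beta
    into one of step 1. *)
Lemma trapezoidC beta x : 0 < beta ->
  trapezoid beta x = beta * (clip beta^-1 x - clip beta^-1 (x - 1)).
Proof.
move=> b0; rewrite /trapezoid /clip; congr (_ * _).
have : 0 < beta^-1 by rewrite invr_gt0.
move: beta^-1 => a a0; rewrite /Num.max /Num.min.
by do ![case: ifPn; rewrite -?leNgt]; lra.
Qed.

Lemma trapezoid_scale beta x : 0 < beta ->
  beta * trapezoid beta^-1 (beta * x) = trapezoid beta x.
Proof.
move=> b0; rewrite trapezoidC ?invr_gt0// invrK mulrA mulfV ?gt_eqF// mul1r.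
have clipM b y : clip (beta * b) (beta * y) = beta * clip b y.
  by rewrite /clip -minr_pMr ?ltW// -[in LHS](mulr0 beta) -maxr_pMr ?ltW.
rewrite /trapezoid mulrBr -!clipM mulr1; congr (_ - clip _ _).
by rewrite mulrBr mulfV// gt_eqF.
Qed.

Lemma trapezoid_eq0 beta x : 0 < beta -> x <= 0 \/ 1 + beta^-1 <= x ->
  trapezoid beta x = 0.
Proof.
move=> b0 x0; rewrite /trapezoid /clip.
have : 0 < beta^-1 by rewrite invr_gt0.
move: beta^-1 x0 => a x0 a0; apply/eqP; rewrite mulf_eq0; apply/orP; right.
by apply/eqP; rewrite /Num.max /Num.min; do ![case: ifPn; rewrite -?leNgt]; lra.
Qed.

Section trapezoid_ge1.
Variables (beta x : R) (b1 : 1 <= beta).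

Let b0 : 0 < beta. Proof. exact: lt_le_trans b1. Qed.
Let ainv : beta * beta^-1 = 1. Proof. by rewrite mulfV// gt_eqF. Qed.
Let a0 : 0 < beta^-1. Proof. by rewrite invr_gt0. Qed.
Let a1 : beta^-1 <= 1. Proof. by rewrite invf_le1. Qed.

Lemma trapezoid_up : 0 <= x <= beta^-1 -> trapezoid beta x = beta * x.
Proof.
move=> xa; rewrite trapezoidC//; congr (_ * _); move: xa; rewrite /clip.
move: beta^-1 a0 a1 => a ? ? /andP[? ?].
by rewrite /Num.max /Num.min; do ![case: ifPn; rewrite -?leNgt]; lra.
Qed.

Lemma trapezoid_flat : beta^-1 <= x <= 1 -> trapezoid beta x = 1.
Proof.
move=> xa; rewrite -[RHS]ainv trapezoidC//; congr (_ * _); move: xa; rewrite /clip.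
move: beta^-1 a0 a1 => a ? ? /andP[? ?].
by rewrite /Num.max /Num.min; do ![case: ifPn; rewrite -?leNgt]; lra.
Qed.

Lemma trapezoid_down : 1 <= x <= 1 + beta^-1 ->
  trapezoid beta x = beta * (1 + beta^-1 - x).
Proof.
move=> xa; rewrite trapezoidC//; congr (_ * _); move: xa; rewrite /clip.
move: beta^-1 a0 a1 => a ? ? /andP[? ?].
by rewrite /Num.max /Num.min; do ![case: ifPn; rewrite -?leNgt]; lra.
Qed.

End trapezoid_ge1.

Lemma rho_irrE beta t : 1 <= beta -> rho_irr beta t = trapezoid beta t.
Proof.
move=> b1; have b0 : 0 < beta by lra.
have a0 : 0 < beta^-1 by rewrite invr_gt0.
have a1 : beta^-1 <= 1 by rewrite invf_le1.
rewrite /rho_irr !in_itv/=.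
have [t0|t0] /= := ltP t 0.
  rewrite (ltNge t 1) (leNgt 1 t) (leNgt _ t) !(lt_le_trans t0) ?(ltW a0)//=.
  by rewrite trapezoid_eq0//; left; exact: ltW.
have [ta|ta] /= := ltP t beta^-1; first by rewrite trapezoid_up// t0 ltW.
have [t1|t1] /= := ltP t 1; first by rewrite trapezoid_flat// ta ltW.
have [t2|t2] /= := leP t (1 + beta^-1); last by rewrite trapezoid_eq0//; right; exact: ltW.
rewrite trapezoid_down// ?t1// mulrBr mulrDr mulfV ?gt_eqF//; ring.
Qed.

(* The left and right steps of height j / q are the cells of index j - 1 and
   p + q - 1 - j. *)
Lemma rho_ratE beta t : rational beta -> 1 <= beta ->
  rho_rat beta t = trapezoid beta (cell_end beta t).
Proof.
move=> bQ b1; have b0 : 0 < beta by lra.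
have [p0 q0 _] := pq_rational bQ b0.
rewrite /rho_rat /cell_end asboolT//.
move: (p_ beta) (q_ beta) p0 q0 => p q p0 q0 bE.
have p0R : 0 < p%:R :> R by rewrite ltr0n.
have q0R : 0 < q%:R :> R by rewrite ltr0n.
have aE : beta^-1 = q%:R / p%:R by rewrite bE invf_div.
have qp : (q <= p)%N by move: b1; rewrite bE ler_pdivlMr// mul1r ler_nat.
set m := Num.floor (p%:R * t).
have cellE (k : int) : (t \in `[k%:~R / p%:R, (k + 1)%:~R / p%:R[) = (k == m).
  by rewrite in_itv/= ler_pdivrMr// ltr_pdivlMr// [t * _]mulrC -floor_eq eq_sym.
have steps j : \1_(`[(j%:R - 1) / p%:R, j%:R / p%:R[ `|`
    `[1 + (q%:R - j%:R - 1) / p%:R, 1 + (q%:R - j%:R) / p%:R[) t =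
    ((j%:Z == m + 1) || (j%:Z == (p + q)%:Z - (m + 1)))%:R :> R.
  rewrite indicE in_setU !mem_setE; congr (_%:R); congr (nat_of_bool (_ || _)).
    have := cellE (j%:Z - 1); rewrite subrK intrB => ->.
    by rewrite subr_eq.
  have := cellE ((p + q)%:Z - j%:Z - 1); rewrite subrK.
  have -> : ((p + q)%:Z - j%:Z - 1)%:~R / p%:R = 1 + (q%:R - j%:R - 1) / p%:R :> R.
    by rewrite !intrB PoszD intrD; field; rewrite gt_eqF.
  have -> : ((p + q)%:Z - j%:Z)%:~R / p%:R = 1 + (q%:R - j%:R) / p%:R :> R.
    by rewrite !intrB PoszD intrD; field; rewrite gt_eqF.
  move=> ->; lia.
have plateau : \1_(`[(q%:R - 1) / p%:R, 1[) t = (q%:Z - 1 <= m < p%:Z)%R%:R :> R.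
  rewrite indicE mem_setE in_itv/=; congr (_%:R); congr (nat_of_bool (_ && _)).
    by rewrite floor_ge_int ler_pdivrMr// mulrC intrB.
  by rewrite floor_lt_int mulrC -ltr_pdivlMr// divff// gt_eqF.
rewrite plateau; under eq_bigr do rewrite steps.
have sum1 (i : nat) : \sum_(1 <= j < q) j%:R / q%:R * (j == i)%:R =
    if (1 <= i < q)%N then i%:R / q%:R else 0 :> R.
  rewrite -(big_nat1_eq +%R (fun j => j%:R / q%:R : R)) [RHS]big_mkcond/=.
  by apply: eq_bigr => j _; rewrite mulr_natr mulrb.
(* The cell lies left of the support, on the rising side, on the plateau, on the falling side, or
   beyond. On either slope exactly one summand survives. *)
have [m0|m0] := ltP m 0.
  rewrite trapezoid_eq0//; last first.
    by left; rewrite pmulr_lle0 ?invr_gt0// lerz0; lia.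
  rewrite big_nat big1 => [|j /andP[j1 jq]].
    by rewrite add0r (_ : _ && _ = false)//; apply/negbTE; lia.
  by rewrite (_ : _ || _ = false) ?mulr0//; apply/negbTE; lia.
have [k mk] : exists k : nat, m = k%:Z by exists `|m|%N; rewrite gez0_abs.
rewrite {m m0 cellE}mk in steps plateau *.
have kE : (k%:Z + 1)%:~R = k.+1%:R :> R by rewrite intrD natr1.
rewrite kE; have [kq|kq] := ltnP k.+1 q.
  rewrite trapezoid_up//; last first.
    by rewrite divr_ge0//= aE ler_pM2r ?invr_gt0// ler_nat ltnW.
  rewrite (_ : _ && _ = false) ?addr0; last by apply/negbTE; lia.
  rewrite (@eq_big_nat _ _ _ _ _ _ (fun j => j%:R / q%:R * (j == k.+1)%:R)); last first.
    by move=> j jq; congr (_ * (nat_of_bool _)%:R); apply/idP/idP; lia.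
  by rewrite sum1 kq/= bE; field; rewrite !gt_eqF.
have [kp|kp] := ltnP k p.
  rewrite trapezoid_flat//; last first.
    by rewrite aE ler_pM2r ?invr_gt0// ler_nat kq/= ler_pdivrMr// mul1r ler_nat.
  rewrite (_ : _ && _ = true); last by lia.
  rewrite big_nat big1 ?add0r//.
  by move=> j /andP[j1 jq]; rewrite (_ : _ || _ = false) ?mulr0//; apply/negbTE; lia.
rewrite (_ : _ && _ = false) ?addr0; last by apply/negbTE; lia.
have aE1 : 1 + beta^-1 = (p + q)%:R / p%:R by rewrite aE natrD; field; rewrite gt_eqF.
have [kpq|kpq] := ltnP k.+1 (p + q).
  rewrite trapezoid_down//; last first.
    rewrite aE1 ler_pM2r ?invr_gt0// ler_nat (ltnW kpq) andbT.
    by rewrite ler_pdivlMr// mul1r ler_nat ltnW.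
  rewrite (@eq_big_nat _ _ _ _ _ _ (fun j => j%:R / q%:R * (j == (p + q - k.+1)%N)%:R)); last first.
    by move=> j jq; congr (_ * (nat_of_bool _)%:R); apply/idP/idP; lia.
  rewrite sum1 (_ : _ && _ = true); last by lia.
  by rewrite aE1 natrB ?(ltnW kpq)// bE; field; rewrite !gt_eqF.
rewrite trapezoid_eq0//; last by right; rewrite aE1 ler_pM2r ?invr_gt0// ler_nat.
rewrite big_nat big1// => j /andP[j1 jq].
by rewrite (_ : _ || _ = false) ?mulr0//; apply/negbTE; lia.
Qed.

Lemma fraction_unique (p q p' q' : nat) : (0 < q)%N -> (0 < q')%N ->
  coprime p q -> coprime p' q' -> p%:R / q%:R = p'%:R / q'%:R :> R ->
  p = p' /\ q = q'.
Proof.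
move=> q0 q'0 pq pq' /eqP.
rewrite eqr_div ?pnatr_eq0 -?lt0n// -!natrM eqr_nat => /eqP E.
have qE : q = q'.
  apply/eqP; rewrite eqn_dvd; apply/andP; split.
    by rewrite -(@Gauss_dvdr q p) ?E ?dvdn_mull// coprime_sym.
  by rewrite -(@Gauss_dvdr q' p') -?E ?dvdn_mull// coprime_sym.
by split=> //; apply/eqP; rewrite -(eqn_pmul2r q'0) E qE.
Qed.

Lemma pq_inv beta : rational beta -> 0 < beta ->
  [/\ rational beta^-1, p_ beta^-1 = q_ beta & q_ beta^-1 = p_ beta].
Proof.
move=> bQ b0; have bVQ : rational beta^-1.
  by case: bQ => [r _ <-]; exists r^-1 => //; rewrite fmorphV.
have [p0 q0 pq bE] := pq_rational bQ b0.
have bV0 : 0 < beta^-1 by rewrite invr_gt0.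
have [p0' q0' pq' bE'] := pq_rational bVQ bV0.
have [] := @fraction_unique (p_ beta^-1) (q_ beta^-1) (q_ beta) (p_ beta) => //.
  by rewrite coprime_sym.
by rewrite -bE' [in LHS]bE invf_div.
Qed.

(** Multiplication by beta = p / q carries the grid of step 1 / p to that of step 1 / q, which is
    the grid attached to 1 / beta. *)
Lemma cell_end_scale beta t : 0 < beta ->
  cell_end beta^-1 (beta * t) = beta * cell_end beta t.
Proof.
move=> b0; rewrite /cell_end; case: (asboolP (rational beta)) => [bQ|bI].
  have [bVQ -> _] := pq_inv bQ b0; have [p0 q0 _ bE] := pq_rational bQ b0.
  have qb : (q_ beta)%:R * beta = (p_ beta)%:R.
    by rewrite [X in _ * X]bE mulrC divfK// pnatr_eq0 -lt0n.
  rewrite asboolT// mulrA qb; move: (Num.floor _ + 1) => z; rewrite -qb.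
  by field; rewrite gt_eqF// pnatr_eq0 -lt0n.
rewrite asboolF// => bVQ; apply: bI; rewrite -[beta]invrK.
by case: bVQ => [r _ <-]; exists r^-1 => //; rewrite fmorphV.
Qed.

Lemma rhoE beta t : 0 < beta -> rho beta t = trapezoid beta (cell_end beta t).
Proof.
move=> b0; rewrite /rho ltNge (ltW b0)/= /rho_pos.
have ge1 b x : 1 <= b -> rho_ge1 b x = trapezoid b (cell_end b x).
  move=> b1; rewrite /rho_ge1; case: asboolP => [bQ|bI]; first by rewrite rho_ratE.
  by rewrite rho_irrE// /cell_end asboolF.
have [/ge1->//|b1] := leP 1 beta.
by rewrite ge1 ?invf_ge1 ?(ltW b1)// cell_end_scale// trapezoid_scale.
Qed.

(** In the rational case 1 is p cells and 1 / beta is q cells, so sampling commutes with both shifts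
    and keeps both difference forms of the trapezoid. *)
Lemma cell_endB1 beta t : 0 < beta -> cell_end beta (t - 1) = cell_end beta t - 1.
Proof.
move=> b0; rewrite /cell_end; case: asboolP => [bQ|//].
have [p0 q0 _ bE] := pq_rational bQ b0.
have -> : (p_ beta)%:R * (t - 1) = (p_ beta)%:R * t + (- (p_ beta)%:Z)%:~R.
  by rewrite intrN mulrBr mulr1.
rewrite floorDrz ?intr_int// intrKfloor !intrD intrN.
by field; rewrite pnatr_eq0 -lt0n.
Qed.

Lemma cell_endBV beta t : 0 < beta ->
  cell_end beta (t - beta^-1) = cell_end beta t - beta^-1.
Proof.
move=> b0; apply: (mulfI (lt0r_neq0 b0)); rewrite -cell_end_scale//.
rewrite !mulrBr mulfV ?gt_eqF// cell_endB1 ?invr_gt0//.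
by rewrite cell_end_scale.
Qed.

Lemma cell_end_le0 beta t : 0 < beta -> t < 0 -> cell_end beta t <= 0.
Proof.
move=> b0 t0; rewrite /cell_end; case: asboolP => [bQ|_]; last exact: ltW.
have [p0 _ _ _] := pq_rational bQ b0.
rewrite pmulr_lle0 ?invr_gt0 ?ltr0n// lerz0.
rewrite -ltzD1 ltrD2r floor_lt_int pmulr_rlt0// ltr0n//.
Qed.

Lemma cell_end_ge beta t : 0 < beta -> t <= cell_end beta t.
Proof.
move=> b0; rewrite /cell_end; case: asboolP => [bQ|//].
have [p0 _ _ _] := pq_rational bQ b0.
by rewrite ler_pdivlMr ?ltr0n// mulrC ltW// floorD1_gt.
Qed.

(** This is where - 1 / p enters [c_]: in the rational case 1 + 1 / beta - 1 / p is the left end of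
    the cell with right end 1 + 1 / beta, where the trapezoid already vanishes. *)
Lemma rho_eq0 beta t : 0 < beta -> t < 0 \/ c_ beta <= t -> rho beta t = 0.
Proof.
move=> b0 t0; rewrite rhoE// trapezoid_eq0//.
case: t0 => [t0|ct]; [by left; exact: cell_end_le0|right]; move: ct.
rewrite /c_ gtr0_norm//; case: asboolP => [bQ|bI] ct; last first.
  exact: le_trans (cell_end_ge _ _).
rewrite /cell_end asboolT//; have [p0 q0 _ bE] := pq_rational bQ b0.
have p0R : 0 < (p_ beta)%:R :> R by rewrite ltr0n.
have aE : beta^-1 = (q_ beta)%:R / (p_ beta)%:R by rewrite {1}bE invf_div.
have : (p_ beta)%:Z + (q_ beta)%:Z - 1 <= Num.floor ((p_ beta)%:R * t).
  rewrite floor_ge_int mulrC -ler_pdivrMr// intrB intrD (le_trans _ ct)//.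
  by rewrite aE mulrBl mulrDl divff ?mul1r// gt_eqF.
rewrite lerBlDr -(ler_int R) intrD => le_floor.
rewrite aE ler_pdivlMr// (le_trans _ le_floor)//.
by rewrite mulrDl mul1r divfK// gt_eqF.
Qed.

Lemma cell_end_nondecreasing beta : 0 < beta ->
  {homo cell_end beta : x y / x <= y}.
Proof.
move=> b0 x y xy; rewrite /cell_end; case: asboolP => [bQ|//].
have [p0 q0 _ bE] := pq_rational bQ b0.
by rewrite ler_pM2r ?invr_gt0 ?ltr0n// ler_int lerD2r le_floor// ler_pM2l// ltr0n.
Qed.

End density.

(** * Periodic sets and uniformity on the circle *)

Section circle.
Context {R : realType}.
Local Notation RR := (measurableTypeR R).
Local Notation lambda := (@lebesgue_measure R).
Local Notation wrap := Defs.wrap.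
Implicit Types (A B : set RR) (m : set RR -> \bar R) (x y d alpha beta : R).
Implicit Types mu : probability RR R.

Lemma affine_measurable alpha beta : 0 <= beta ->
  measurable_fun setT (affine alpha beta : RR -> RR).
Proof.
move=> b0; apply: nondecreasing_measurable => // x y xy.
by rewrite /affine lerD2r ler_wpM2l.
Qed.

Lemma fracpart_measurable : measurable_fun setT (fracpart : RR -> RR).
Proof.
apply: measurable_funB => //; apply: nondecreasing_measurable => // x y xy.
by rewrite ler_int le_floor.
Qed.

Lemma measurable_preimageT (f : RR -> RR) A : measurable_fun setT f ->
  measurable A -> measurable (f @^-1` A).
Proof. by move=> mf mA; rewrite -[X in measurable X]setTI; exact: mf. Qed.

Lemma lebesgue_affine alpha beta A : 0 < beta -> measurable A ->
  (lambda A = beta%:E * lambda (affine alpha beta @^-1` A))%E.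
Proof.
move=> b0 mA.
have mf := affine_measurable alpha (ltW b0).
apply: (@lebesgue_measure_unique R (mscale (NngNum (ltW b0))
  (pushforward lambda (affine alpha beta : RR -> RR)))) => //= _ [[u v]] _ <-.
rewrite /mscale /= -[X in (_ * X)%E]/(lambda (affine alpha beta @^-1` `]u, v])).
have -> : affine alpha beta @^-1` `]u, v] =
    `](u - alpha) / beta, (v - alpha) / beta]%classic.
  apply/seteqP; split => x /=; rewrite /affine !in_itv/= ltr_pdivrMr//
    ler_pdivlMr// [x * _]mulrC ltrBlDr lerBrDr//.
rewrite !lebesgue_measure_itv/= !lte_fin ltr_pM2r ?invr_gt0// ltrD2r.
case: ifPn => _; last by rewrite mule0.
by rewrite -!EFinD -EFinM; congr EFin; field; rewrite gt_eqF.
Qed.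

Lemma lebesgue_shift d A : measurable A -> lambda (translation d @^-1` A) = lambda A.
Proof.
move=> mA; rewrite (lebesgue_affine d ltr01 mA) mul1e.
have -> // : translation d = affine d 1.
by apply/funext => x; rewrite /affine mul1r.
Qed.

Definition periodic1 B := forall x, B (x + 1) = B x.

Lemma periodic1_int B (z : int) x : periodic1 B -> B (x + z%:~R) = B x.
Proof.
move=> pB; have nat (n : nat) y : B (y + n%:R) = B y.
  elim: n y => [|n ih] y; first by rewrite addr0.
  by rewrite -natr1 addrA pB ih.
by case: z => n; [exact: nat | rewrite NegzE intrN -(nat n.+1) subrK].
Qed.

(** With n the floor of x, the window is cut at n + 1 and its right piece moved back by 1, which
    gives [n, n + 1[. *)
Lemma lebesgue_periodic B x : measurable B -> periodic1 B ->
  lambda (B `&` `[x, x + 1[) = lambda (B `&` `[0, 1[).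
Proof.
move=> mB pB.
have int (z : int) u v : lambda (B `&` `[u + z%:~R, v + z%:~R[) = lambda (B `&` `[u, v[).
  rewrite -(@lebesgue_shift z%:~R); last exact: measurableI.
  congr (lambda _); apply/seteqP; split => y /=; rewrite /translation periodic1_int//.
    by rewrite !in_itv/= lerD2r ltrD2r.
  by rewrite !in_itv/= lerD2r ltrD2r.
pose n := Num.floor x; have /andP[nx xn] := floor_itv x; rewrite -/n in nx xn.
have cat u v w : u <= v -> v <= w -> (lambda (B `&` `[u, w[) =
    lambda (B `&` `[u, v[) + lambda (B `&` `[v, w[))%E.
  move=> uv vw; rewrite -measureU//; try exact: measurableI.
    rewrite -setIUr; congr (lambda (_ `&` _)).
    apply/seteqP; split => y /=; rewrite !in_itv/=; last by move=> [] /andP[]; lra.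
    by move=> /andP[uy yw]; have [yv|vy] := ltP y v; [left|right]; apply/andP; split.
  by apply/seteqP; split => y //= [[_ +] [_ +]]; rewrite !in_itv/=; lra.
rewrite (cat _ (n + 1)%:~R); [|exact: ltW|by rewrite intrD; lra].
rewrite intrD addeC.
have -> : lambda (B `&` `[n%:~R + 1%:~R, x + 1[) = lambda (B `&` `[n%:~R, x[).
  exact: (int 1).
rewrite -cat//; last by move: xn; rewrite intrD => /ltW.
by have := int n 0 1; rewrite add0r [1 + _]addrC => ->.
Qed.

(** Reflection turns [0, 1[ into ]-1, 0], hence this variant. Both half-open windows differ from the
    open one by a null point. *)
Lemma lebesgue_periodic_oc B x : measurable B -> periodic1 B ->
  lambda (B `&` `]x, x + 1]) = lambda (B `&` `[0, 1[).
Proof.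
move=> mB pB; rewrite -(lebesgue_periodic x mB pB).
have mo : measurable (B `&` `]x, x + 1[) by exact: measurableI.
have add y C : measurable C -> B `&` `]x, x + 1[ `<=` C ->
    C `<=` (B `&` `]x, x + 1[) `|` [set y] -> lambda C = lambda (B `&` `]x, x + 1[).
  move=> mC sC Cs; apply/eqP; rewrite eq_le; apply/andP; split; last first.
    by apply: le_measure; rewrite ?inE.
  rewrite -[leRHS](@measureU0 _ _ _ lambda _ [set y])//; last first.
    exact: lebesgue_measure_set1.
  by apply: le_measure; rewrite ?inE//; exact: measurableU.
rewrite (add (x + 1)); [|exact: measurableI| |].
- rewrite (add x)//; first exact: measurableI.
    by move=> y [By]; rewrite /= !in_itv/= => /andP[/ltW-> ->].
  move=> y [By]; rewrite /= !in_itv/= le_eqVlt => /andP[/orP[/eqP->|xy] yx].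
    by right.
  by left; split => //; rewrite /= ?in_itv/= xy.
- by move=> y [By]; rewrite /= !in_itv/= => /andP[-> /ltW->].
- move=> y [By]; rewrite /= !in_itv/= le_eqVlt => /andP[xy /orP[/eqP->|yx]].
    by right.
  by left; split => //; rewrite /= ?in_itv/= xy.
Qed.

Lemma fracpartDz x (z : int) : fracpart (x + z%:~R) = fracpart x.
Proof.
by rewrite /fracpart floorDrz ?intr_int// intrKfloor intrD; ring.
Qed.

Lemma fracpart_id x : 0 <= x < 1 -> fracpart x = x.
Proof.
by move=> x01; rewrite /fracpart (@floor_def _ _ 0) ?subr0// add0r.
Qed.

Lemma fracpart_decomp x : exists z : int, x = fracpart x + z%:~R.
Proof. by exists (Num.floor x); rewrite /fracpart subrK. Qed.

Lemma fracpart_periodic A : periodic1 (fracpart @^-1` A).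
Proof. by move=> x /=; rewrite -[1]/(1%:~R) fracpartDz. Qed.

Lemma fracpart_preimage_measurable A :
  measurable A -> measurable (fracpart @^-1` A : set RR).
Proof. by apply: measurable_preimageT; exact: fracpart_measurable. Qed.

Lemma lambda_circle_fracpart A :
  lambda (fracpart @^-1` A `&` `[0, 1[) = lambda_circle A.
Proof.
rewrite /lambda_circle; congr (lambda _).
by apply/seteqP; split => x /= []; rewrite in_itv/= => + x01;
  rewrite fracpart_id.
Qed.

(** The second hypothesis makes [g] descend to the circle, and the third makes the induced map
    preserve the uniform measure. *)
Lemma wrap_push m (g : RR -> RR) : measurable_fun setT g ->
  (forall x (z : int), fracpart (g (x + z%:~R)) = fracpart (g x)) ->
  (forall A, measurable A ->
     lambda_circle ((fracpart \o g) @^-1` A) = lambda_circle A) ->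
  eq_meas (wrap m) lambda_circle -> eq_meas (wrap (push m g)) lambda_circle.
Proof.
move=> mg gz gA mE A mA; rewrite -[RHS]gA// -mE; last first.
  apply: measurable_preimageT => //.
  by apply: measurableT_comp => //; exact: fracpart_measurable.
congr (m _); apply/funext => x /=; rewrite /preimage/=; congr (A _).
by have [z xE] := fracpart_decomp x; rewrite {1}xE gz.
Qed.

Lemma wrap_translation m d : eq_meas (wrap m) lambda_circle ->
  eq_meas (wrap (push m (translation d))) lambda_circle.
Proof.
apply: wrap_push => [|x z|A mA]; first by apply: measurable_funD.
  by rewrite /translation addrAC fracpartDz.
rewrite {1}/lambda_circle; set B := fracpart @^-1` A.
have mB : measurable B by exact: fracpart_preimage_measurable.
have -> : (fracpart \o translation d) @^-1` A `&` `[0, 1[ =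
    translation d @^-1` (B `&` `[d, d + 1[).
  apply/seteqP; split => x /= [Ax]; rewrite /translation !in_itv/= => x01;
    split => //; move: x01; rewrite ?in_itv/=; lra.
rewrite lebesgue_shift; last exact: measurableI.
by rewrite lebesgue_periodic ?lambda_circle_fracpart//; exact: fracpart_periodic.
Qed.

Lemma wrap_opp m : eq_meas (wrap m) lambda_circle ->
  eq_meas (wrap (push m -%R)) lambda_circle.
Proof.
apply: wrap_push => [|x z|A mA]; first exact: oppr_measurable.
  by rewrite opprD -intrN fracpartDz.
rewrite {1}/lambda_circle; set B := fracpart @^-1` A.
have mB : measurable B by exact: fracpart_preimage_measurable.
have -> : (fracpart \o -%R) @^-1` A `&` `[0, 1[ =
    -%R @^-1` (B `&` `]-1, -1 + 1]).
  apply/seteqP; split => x /= [Ax]; rewrite !in_itv/= => x01;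
    split => //; move: x01; rewrite ?in_itv/=; lra.
rewrite -[LHS]/(pushforward lambda (-%R : RR -> RR) _) lebesgue_measureN.
  rewrite lebesgue_periodic_oc ?lambda_circle_fracpart//.
  exact: fracpart_periodic.
exact: measurableI.
Qed.

(** A change of alpha rotates the image on the circle and a change of sign of beta reflects it. The
    theorem is thereby reduced to alpha = 0 and beta > 0. *)
Lemma CIUPM_affine alpha beta : beta != 0 ->
  CIUPM (affine alpha beta) = CIUPM (affine 0 `|beta|) :> set (probability RR R).
Proof.
move=> b0.
have shift m a a' b : eq_meas (wrap (push m (affine a b))) lambda_circle ->
    eq_meas (wrap (push m (affine a' b))) lambda_circle.
  move=> /(@wrap_translation _ (a' - a)).
  have -> // : push (push m (affine a b)) (translation (a' - a)) = push m (affine a' b).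
  apply/funext => A; congr (m _); apply/seteqP.
  by split=> x; rewrite /= /translation /affine -addrA subrKC.
have opp m b : eq_meas (wrap (push m (affine 0 b))) lambda_circle ->
    eq_meas (wrap (push m (affine 0 (- b)))) lambda_circle.
  move=> /wrap_opp.
  have -> // : push (push m (affine 0 b)) -%R = push m (affine 0 (- b)).
  apply/funext => A; congr (m _); apply/seteqP.
  by split=> x; rewrite /= /affine !addr0 mulNr.
have absE m : eq_meas (wrap (push m (affine 0 `|beta|))) lambda_circle <->
    eq_meas (wrap (push m (affine 0 beta))) lambda_circle.
  case: (ler0P beta) => // _; split => [/opp|/opp//].
  by rewrite opprK.
apply/seteqP; split => mu [mu1 mub]; split => //.
  by apply/absE; exact: shift mub.
by move/absE : mub; exact: shift.
Qed.

(** Translating the law by gamma amounts to adding |beta| gamma to the intercept, and [CIUPM_affine]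
    allows any intercept. *)
Lemma CIUPM_translation alpha beta gamma mu (nu : probability RR R) : beta != 0 ->
  eq_meas nu (push mu (translation gamma)) ->
  CIUPM (affine alpha beta) mu -> CIUPM (affine alpha beta) nu.
Proof.
move=> b0 nuE; rewrite (CIUPM_affine alpha b0).
have nb0 : `|beta| != 0 by rewrite normr_eq0.
have := CIUPM_affine (`|beta| * gamma) nb0; rewrite normr_id => affE.
move=> muU; split.
  have [/(@wrap_translation _ gamma) mu1 _] := muU.
  move=> A mA; rewrite -mu1//; apply: nuE; exact: fracpart_preimage_measurable.
move: muU; rewrite -affE => -[_ mub] A mA; rewrite -mub//.
rewrite [LHS]nuE; last first.
  apply: measurable_preimageT; first exact: affine_measurable.
  exact: fracpart_preimage_measurable.
congr (mu _); apply/seteqP; split=> x /=; rewrite /translation /affine addr0 mulrDr//.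
Qed.

End circle.

(** * From uniform laws to distribution functions; uniqueness and minimal length *)

Section uniform_measures.
Context {R : realType}.
Local Notation RR := (measurableTypeR R).
Local Notation lambda := (@lebesgue_measure R).
Local Notation wrap := Defs.wrap.
Implicit Types (A B C : set RR) (s c h t x : R).
Implicit Types mu nu : probability RR R.

Lemma full_measureI mu A C : measurable A -> measurable C -> mu C = 1%E ->
  mu (A `&` C) = mu A.
Proof.
move=> mA mC C1; rewrite -[in RHS](setIT A) -(setvU C) setIUr.
rewrite setUC measureU0//; [exact: measurableI| |].
  by apply: measurableI => //; exact: measurableC.
apply/eqP; rewrite eq_le measure_ge0 andbT.
apply: (@le_trans _ _ (mu (~` C))).
  by apply: le_measure; rewrite ?inE//; [apply: measurableI => //|];
    exact: measurableC.
by rewrite probability_setC// C1 subee.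
Qed.

Lemma cdf_unique mu nu :
  (forall t, mu `]-oo, t]%classic = nu `]-oo, t]%classic) -> eq_meas mu nu.
Proof.
move=> cdfE A mA.
apply: (@measure_unique _ R RR (@ocitv R) (fun n => `](- n%:R)%R, n%:R]%classic)
  erefl _ _ _ mu nu) => //.
- exact: ocitvI.
- by move=> i; exact: is_ocitv.
- apply/seteqP; split => // x _.
  exists (Num.truncn `|x|).+1 => //=; rewrite in_itv/=.
  have := truncnS_gt `|x|; rewrite ltr_norml => /andP[-> /ltW ->//].
- move=> _ [[a b] _ <-] /=.
  have cdfD (P : probability RR R) : P `]a, b]%classic =
      (P `]-oo, b]%classic - P (`]-oo, a]%classic `&` `]-oo, b]%classic))%E.
    rewrite setIC -measureD ?fin_num_measure//; last first.
      by rewrite -ge0_fin_numE// fin_num_measure.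
    congr (P _); apply/seteqP; split => x /=; rewrite !in_itv/=.
      by move=> /andP[ax xb]; split => //; apply/negP; rewrite -ltNge.
    by move=> [-> /negP]; rewrite -ltNge => ->.
  have itvI : `]-oo, a]%classic `&` `]-oo, b]%classic = `]-oo, Num.min a b]%classic :> set R.
    by apply/seteqP; split => x /=; rewrite !in_itv/= le_min => /andP.
  by rewrite !cdfD itvI !cdfE.
- by move=> k; rewrite (le_lt_trans (probability_le1 _ _)) ?ltry.
Qed.

Definition cdf_from mu s t : R := fine (mu `]-oo, s + t]%classic).

Section lattice_sum_uniform.
Variables (mu : probability RR R) (s c h : R).
Hypotheses (h0 : 0 < h) (mu1 : mu `[s, s + c]%classic = 1%E)
  (muh : eq_meas (wrap (push mu (affine (- (s / h)) h^-1))) lambda_circle).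

Local Notation F := (cdf_from mu s).

Lemma cdf_from_nondecreasing : {homo F : x y / x <= y}.
Proof.
move=> x y xy; rewrite fine_le ?fin_num_measure//.
apply: le_measure; rewrite ?inE// => z /=; rewrite !in_itv/= => /le_trans; apply.
by rewrite lerD2l.
Qed.

Lemma cdf_from_le1 t : F t <= 1.
Proof. by rewrite -lee_fin fineK ?fin_num_measure// probability_le1. Qed.

Lemma cdf_from_eq1 t : c <= t -> F t = 1.
Proof.
move=> ct; apply/eqP; rewrite eq_le cdf_from_le1/= -lee_fin fineK ?fin_num_measure//.
rewrite -mu1; apply: le_measure; rewrite ?inE// => z /=; rewrite !in_itv/=.
by move=> /andP[_ /le_trans]; apply; rewrite lerD2l.
Qed.

(** At t = 0 an atom at [s] must be excluded: the residue class of [s] modulo [h] is null by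
    uniformity. *)
Lemma cdf_from_le0 t : t <= 0 -> F t = 0.
Proof.
move=> t0; rewrite /cdf_from -(full_measureI _ _ mu1)//.
have mP : measurable ((fracpart \o affine (- (s / h)) h^-1) @^-1` [set 0] : set RR).
  apply: measurable_preimageT => //.
  apply: measurableT_comp; first exact: fracpart_measurable.
  by apply: affine_measurable; rewrite invr_ge0 ltW.
rewrite (@subset_measure0 _ _ _ mu _ _ _ mP) ?fine0//.
- exact: measurableI.
- move=> x /= []; rewrite !in_itv/= => xst /andP[sx _].
  have -> : x = s by lra.
  by rewrite /affine mulrC subrr fracpart_id// lexx ltr01.
- have := muh (measurable_set1 0); rewrite /lambda_circle => E.
  apply/eqP; rewrite eq_le measure_ge0 andbT.
  apply: (@le_trans _ _ (lambda [set (0 : R)])); last by rewrite lebesgue_measure_set1.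
  rewrite [leLHS]E; apply: le_measure; rewrite ?inE//.
  exact: measurableI.
Qed.

(** The increment adds up the masses of the disjoint intervals [I k]. Inside [s, s + c] they form
    the set of points with (x - s) / h in ]0, z] modulo 1, which has mass [z] by uniformity. *)
Let step (n : nat) z : c <= n%:R * h -> 0 <= z -> z < 1 ->
  lattice_sum h F ((n%:R + z) * h) = lattice_sum h F (n%:R * h) + z.
Proof.
move=> cn z0 z1.
have itvh k : (n%:R + z) * h - k%:R * h = (n%:R - k%:R + z) * h by ring.
rewrite !(@lattice_sumE _ _ _ _ n.+1)//; try exact: cdf_from_le0; last 2 first.
- by rewrite ler_pM2r// ler_nat.
- by rewrite ler_pM2r// -natr1 lerD2l ltW.
pose I k : set RR := `]s + (n%:R - k%:R) * h, s + (n%:R - k%:R + z) * h]%classic.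
have FI k : F ((n%:R + z) * h - k%:R * h) - F (n%:R * h - k%:R * h) = fine (mu (I k)).
  rewrite itvh -mulrBl; set x := n%:R - k%:R.
  have xz : x * h <= (x + z) * h by rewrite ler_pM2r// lerDl.
  rewrite /cdf_from -fineB ?fin_num_measure//; congr fine.
  have /setIidr <- : (`]-oo, s + x * h]%classic : set RR) `<=` `]-oo, s + (x + z) * h]%classic.
    by move=> y /=; rewrite !in_itv/= => /le_trans; apply; rewrite lerD2l.
  rewrite -measureD//; last by rewrite -ge0_fin_numE// fin_num_measure.
  congr (mu _); apply/seteqP; split => y; rewrite /I /= !in_itv/=.
    by move=> [-> /negP]; rewrite -ltNge => ->.
  by move=> /andP[xy ->]; split => //; apply/negP; rewrite -ltNge.
have inI k y : I k (s + y * h) <-> n%:R - k%:R < y <= n%:R - k%:R + z.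
  by rewrite /I /= in_itv/= ltrD2l ltr_pM2r// lerD2l ler_pM2r.
have yE x : x = s + ((x - s) / h) * h by rewrite divfK ?gt_eqF// addrC subrK.
have floorI k x : I k x -> Num.floor ((x - s) / h) = n%:Z - k%:Z.
  rewrite [in X in X -> _](yE x) inI => /andP[nk kn]; apply: floor_def.
  by rewrite !(intrD, intrN) -!pmulrn (ltW nk)/=; lra.
have tI : trivIset setT I.
  apply/trivIsetP => i j _ _ ij; apply/seteqP; split => // x [/floorI + /floorI].
  by move=> -> => ?; move/negP : ij; apply; lia.
have mI k : measurable (I k) by exact: measurable_itv.
pose P : set RR := (fracpart \o affine (- (s / h)) h^-1) @^-1` `]0, z]%classic.
have mP : measurable P.
  apply: measurable_preimageT => //.
  apply: measurableT_comp; first exact: fracpart_measurable.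
  by apply: affine_measurable; rewrite invr_ge0 ltW.
have muP : mu P = z%:E.
  have := muh (measurable_itv `]0, z]); rewrite -[LHS]/(mu P) => ->.
  rewrite /lambda_circle setIidl; last first.
    by move=> x /=; rewrite !in_itv/= => /andP[/ltW-> /le_lt_trans->].
  rewrite lebesgue_measure_itv/= lte_fin; case: ltP => [_|z0']; first by rewrite oppr0 adde0.
  by congr EFin; apply/eqP; rewrite eq_le z0.
apply/eqP; rewrite [eqbRHS]addrC -subr_eq -sumrB; apply/eqP.
transitivity (fine (\sum_(k < n.+1) mu (I k))).
  rewrite -sum_fine; last by move=> i _; rewrite fin_num_measure.
  by rewrite big_mkord; apply: eq_bigr => k _; exact: FI.
transitivity (fine (mu (\big[setU/set0]_(k < n.+1) I k))).
  by rewrite measure_bigsetU.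
rewrite -(full_measureI _ _ mu1)//; last exact: bigsetU_measurable.
rewrite -[RHS]/(fine z%:E) -muP -(full_measureI mP _ mu1)//; congr (fine (mu _)).
have affE x : affine (- (s / h)) h^-1 x = (x - s) / h by rewrite /affine; ring.
rewrite -bigcup_mkord; apply/seteqP; split => x [xP xs]; split => //.
  have [k /= kn kx] := xP; rewrite /P /= affE in_itv/= /fracpart (floorI _ _ kx).
  move: kx; rewrite [in X in X -> _](yE x) inI !(intrD, intrN) -!pmulrn.
  by move=> /andP[? ?]; apply/andP; split; lra.
move: xP; rewrite /P /= affE in_itv/= /fracpart.
(* From c <= n h, the integer part is at most [n], so one of the n + 1 intervals contains the
   point. *)
have [y0 yn] : 0 <= (x - s) / h /\ (x - s) / h <= n%:R.
  move: xs; rewrite /= in_itv/= => /andP[? ?]; split.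
    by rewrite divr_ge0 ?(ltW h0)//; lra.
  by rewrite ler_pdivrMr//; lra.
have j0 : 0 <= Num.floor ((x - s) / h) by rewrite floor_ge0.
have jn : Num.floor ((x - s) / h) <= n%:Z.
  by rewrite -(ler_int R) (le_trans (floor_le _)).
move: (Num.floor _) j0 jn => [j|//] _; rewrite lez_nat => jn /andP[j0 jz].
exists (n - j)%N => /=; first by rewrite ltnS leq_subr.
rewrite (yE x) inI natrB//; move: j0 jz; rewrite -!pmulrn => ? ?.
by apply/andP; split; lra.
Qed.

(** The difference [D] has period [h] on [c - h, +oo[ because F = 1 beyond [c]. It is constant far
    to the right by [step], hence everywhere on that half-line. *)
Lemma lattice_sum_uniform :
  exists K, forall t, c - h <= t -> lattice_sum h F t = t / h + K.
Proof.
pose D t := lattice_sum h F t - t / h.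
have F0 := cdf_from_le0.
have per t (n : nat) : c - h <= t -> D (t + n%:R * h) = D t.
  apply: (@iter_period _ D (c - h)) => [|x cx]; first exact: ltW.
  rewrite /D lattice_sumS// addrK cdf_from_eq1; last lra.
  by field; rewrite gt_eqF.
pose n0 := (Num.truncn (c / h)).+1.
have cn0 n : (n0 <= n)%N -> c <= n%:R * h.
  move=> nn; rewrite -ler_pdivrMr// (le_trans (ltW (truncnS_gt _)))//.
  by rewrite ler_nat.
have DE n z : (n0 <= n)%N -> 0 <= z -> z < 1 -> D ((n%:R + z) * h) = D (n0%:R * h).
  move=> nn z0 z1; rewrite {1}/D step//; last exact: cn0.
  rewrite -(per (n0%:R * h) (n - n0)%N); last first.
    by rewrite lerBlDr ler_wpDr ?(ltW h0)// cn0.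
  have -> : n0%:R * h + (n - n0)%:R * h = n%:R * h by rewrite natrB//; ring.
  by rewrite /D; field; rewrite gt_eqF.
exists (D (n0%:R * h)) => t ct.
suff <- : D t = D (n0%:R * h) by rewrite /D; ring.
pose m := (Num.truncn `|n0%:R - t / h|).+1.
have tm : n0%:R * h <= t + m%:R * h.
  rewrite -lerBlDl -ler_pdivrMr// mulrBl mulfK ?gt_eqF//.
  by rewrite (le_trans (ler_norm _))// ltW// truncnS_gt.
rewrite -(per _ m)//; set x := t + m%:R * h in tm *.
have x0 : 0 <= x / h by rewrite divr_ge0 ?(ltW h0)// (le_trans _ tm)// mulr_ge0// ltW.
have /andP[nx xn] := truncn_itv x0; set n := Num.truncn _ in nx xn.
have -> : x = (n%:R + (x / h - n%:R)) * h by rewrite addrC subrK divfK// gt_eqF.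
apply: DE; [|lra|by move: xn; rewrite -natr1; lra].
by rewrite /n truncn_ge_nat// ler_pdivlMr.
Qed.

End lattice_sum_uniform.

Lemma uniform_cdf_from mu beta s c : 0 < beta -> CIUPM (affine 0 beta) mu ->
  mu `[s, s + c]%classic = 1%E -> uniform_cdf beta^-1 c (cdf_from mu s).
Proof.
move=> b0 muU mu1.
have unif h : 0 < h -> eq_meas (wrap (push mu (affine (- (s / h)) h^-1))) lambda_circle ->
    exists K, forall t, c - h <= t -> lattice_sum h (cdf_from mu s) t = t / h + K.
  by move=> h0 muh; exact: lattice_sum_uniform h0 mu1 muh.
have bV0 : 0 < beta^-1 by rewrite invr_gt0.
have nb : beta^-1^-1 != 0 by rewrite invrK gt_eqF.
(* The intercept puts the origin of residues at [s], as [lattice_sum_uniform] requires. *)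
have [mu_wrap muV] : CIUPM (affine (- (s / beta^-1)) beta^-1^-1) mu.
  by have -> := CIUPM_affine (- (s / beta^-1)) nb; rewrite invrK gtr0_norm.
split.
- exact: cdf_from_nondecreasing.
- by move=> t; exact: (cdf_from_le0 bV0 mu1).
- exact: cdf_from_le1.
-
  have [] := unif 1 ltr01.
    have -> : affine (- (s / 1)) 1^-1 = translation (- s).
      by apply/funext => x; rewrite /affine /translation divr1 invr1 mul1r.
    exact: wrap_translation.
  by move=> K KE; exists K => t /KE; rewrite divr1.
- exact: unif.
Qed.

Lemma full_itv_widen mu s c s' c' : s' <= s -> s + c <= s' + c' ->
  mu `[s, s + c]%classic = 1%E -> mu `[s', s' + c']%classic = 1%E.
Proof.
move=> ss cc mu1; apply/eqP; rewrite eq_le probability_le1//= -mu1.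
apply: le_measure; rewrite ?inE// => x /=; rewrite !in_itv/= => /andP[? ?].
by apply/andP; split; lra.
Qed.

Lemma CIUPM_unique mu nu beta s r : 0 < beta ->
  CIUPM (affine 0 beta) mu -> CIUPM (affine 0 beta) nu ->
  mu `[s, s + c_ beta]%classic = 1%E -> nu `[r, r + c_ beta]%classic = 1%E ->
  forall t, mu `]-oo, s + t]%classic = nu `]-oo, r + t]%classic.
Proof.
move=> b0 muU nuU mu1 nu1 t.
have FE := uniform_cdf_unique t b0 (uniform_cdf_from b0 muU mu1)
  (uniform_cdf_from b0 nuU nu1).
rewrite -[LHS]fineK ?fin_num_measure// -[RHS]fineK ?fin_num_measure//.
by congr EFin; exact: FE.
Qed.

(** A shorter carrier fits in two intervals of length c_beta whose left ends differ by d > 0. By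
    uniqueness the distribution function is then invariant under the shift by [d], and enough shifts
    move s + c to the left of [s], where there is no mass. *)
Lemma CIUPM_length mu beta s c : 0 < beta -> CIUPM (affine 0 beta) mu ->
  mu `[s, s + c]%classic = 1%E -> c_ beta <= c.
Proof.
move=> b0 muU mu1; rewrite leNgt; apply/negP => cc.
pose d := c_ beta - c; have d0 : 0 < d by rewrite subr_gt0.
have per t : mu `]-oo, t]%classic = mu `]-oo, t - d]%classic.
  have := @CIUPM_unique mu mu beta s (s - d) b0 muU muU _ _ (t - s).
  have -> : s + (t - s) = t by ring.
  have -> : s - d + (t - s) = t - d by ring.
  apply.
  - by apply: full_itv_widen mu1 => //; rewrite /d in d0; lra.
  - by apply: full_itv_widen mu1; rewrite /d in d0 *; lra.
have {}per t (n : nat) : mu `]-oo, t]%classic = mu `]-oo, t - n%:R * d]%classic.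
  elim: n => [|n ->]; first by rewrite mul0r subr0.
  by rewrite per; have -> : t - n%:R * d - d = t - n.+1%:R * d by rewrite -natr1; ring.
have : mu `]-oo, s + c]%classic = 1%E.
  apply/eqP; rewrite eq_le probability_le1//= -mu1.
  by apply: le_measure; rewrite ?inE// => x /=; rewrite !in_itv/= => /andP[].
rewrite (per _ (Num.truncn (`|c| / d)).+1) -(full_measureI _ _ mu1)//.
set x := s + c - _; rewrite (_ : _ `&` _ = set0).
  by rewrite measure0 => /eqP; rewrite eq_sym onee_eq0.
apply/seteqP; split => // y [] /=; rewrite !in_itv/= => yx /andP[sy _].
have : `|c| < (Num.truncn (`|c| / d)).+1%:R * d by rewrite -ltr_pdivrMr// truncnS_gt.
by have := ler_norm c; rewrite /x in yx; lra.
Qed.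

(** The intersection is again written as left end plus length, the form that [CIUPM_length]
    takes. *)
Lemma full_itvI mu s c s' c' : mu `[s, s + c]%classic = 1%E ->
  mu `[s', s' + c']%classic = 1%E ->
  mu `[Num.max s s',
       Num.max s s' + (Num.min (s + c) (s' + c') - Num.max s s')]%classic = 1%E.
Proof.
move=> mu1 mu1'; rewrite addrC subrK -[RHS]mu1 -[RHS](full_measureI _ _ mu1')//.
congr (mu _); apply/seteqP; split => x /=; rewrite !in_itv/= ge_max le_min.
  by move=> /andP[/andP[? ?] /andP[? ?]]; split; apply/andP.
by move=> [/andP[? ?] /andP[? ?]]; apply/andP; split; apply/andP.
Qed.

End uniform_measures.

(** * The support and its diameter *)

Section support.
Context {R : realType}.
Local Notation RR := (measurableTypeR R).
Implicit Types (s c x : R) (mu : probability RR R).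

Lemma closed_supp mu : closed (supp mu).
Proof. by apply: closed_bigI => C []. Qed.

Lemma not_supp_null mu x : ~ supp mu x ->
  exists q r : rat, [/\ ratr q < x, x < ratr r & mu `]ratr q, ratr r[%classic = 0%E].
Proof.
move=> /existsNP[C /not_implyP[[cC C1] Cx]].
have /nbhs_ballP[e /= e0 eC] : nbhs x (~` C).
  by apply: open_nbhs_nbhs; split => //; exact: closed_openC.
have [q] := @rat_in_itvoo R (x - e) x ltac:(lra).
have [r] := @rat_in_itvoo R x (x + e) ltac:(lra).
rewrite !in_itv/= => /andP[xr re] /andP[eq qx]; exists q, r; split => //.
rewrite -(full_measureI _ (closed_measurable cC) C1)// (_ : _ `&` _ = set0) ?measure0//.
apply/seteqP; split => // y /= []; rewrite in_itv/= => /andP[qy yr] Cy.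
apply: (eC y) => //; rewrite /ball/= ltr_norml; apply/andP; split; lra.
Qed.

(* Lindelof: the complement of the support is covered by the null intervals
   with rational endpoints. *)
Lemma supp_full mu : mu (supp mu) = 1%E.
Proof.
have mS : measurable (supp mu : set RR) by apply: closed_measurable; exact: closed_supp.
pose F (k : nat) : set RR := if unpickle k is Some (q, r) then
  if mu `]ratr q, ratr r[%classic == 0%E then `]ratr q, ratr r[%classic else set0
  else set0.
have F0 k : mu.-negligible (F k).
  rewrite /F; case: unpickle => [[q r]|]; last exact: negligible_set0.
  by case: ifPn => [/eqP q0|_]; [apply/negligibleP|exact: negligible_set0].
have N0 : mu (~` supp mu) = 0%E.
  apply: measure_negligible; first exact: measurableC.
  apply: negligibleS (negligible_bigcup F0) => x /not_supp_null[q [r [qx xr q0]]].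
  exists (pickle (q, r)); [exact: I|rewrite /F pickleK q0 eqxx].
  by rewrite /= in_itv/= qx.
by have := probability_setC mu (measurableC mS); rewrite setCK N0 sube0.
Qed.

(** The left end is the infimum of the support, which belongs to the support by closedness. *)
Lemma diam_classP mu c : diam_class c mu -> exists s, mu `[s, s + c]%classic = 1%E.
Proof.
move=> dc.
have dist x y : supp mu x -> supp mu y -> `|x - y| <= c.
  move=> sx sy; rewrite -lee_fin -dc; apply: ereal_sup_ubound.
  by exists (x, y).
have [x0 sx0] : supp mu !=set0.
  apply/set0P/eqP => s0; have := supp_full mu; rewrite s0 measure0 => /eqP.
  by rewrite eq_sym onee_eq0.
have lb : has_lbound (supp mu).
  by exists (x0 - c) => x /(dist _ _ sx0); rewrite ler_norml; lra.
have si : supp mu (inf (supp mu)).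
  apply: (@closed_supp mu) => B /nbhs_ballP[e /= e0 eB].
  have [|y sy ye] := @inf_adherent _ (supp mu) e e0; first by split => //; exists x0.
  exists y; split => //; apply: eB; rewrite /ball/= distrC ger0_norm ?subr_ge0 ?ge_inf//.
  by rewrite ltrBlDl.
exists (inf (supp mu)); apply/eqP; rewrite eq_le probability_le1//= -(supp_full mu).
apply: le_measure; rewrite ?inE//; first by apply: closed_measurable; exact: closed_supp.
move=> x sx; rewrite /= in_itv/= ge_inf//=.
by have := dist _ _ sx si; rewrite ler_norml; lra.
Qed.

Lemma diam_supp_le mu s c : mu `[s, s + c]%classic = 1%E ->
  exists2 d, d <= c & diam_class d mu.
Proof.
move=> mu1.
have sub x : supp mu x -> s <= x <= s + c.
  move=> /(_ `[s, s + c]%classic); rewrite /= in_itv/=; apply; split => //.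
  exact: interval_closed.
have [x0 sx0] : supp mu !=set0.
  apply/set0P/eqP => s0; have := supp_full mu; rewrite s0 measure0 => /eqP.
  by rewrite eq_sym onee_eq0.
have dc : (diam (supp mu) <= c%:E)%E.
  apply: ub_ereal_sup => _ [[x y] /= [/sub ? /sub ?] <-].
  by rewrite lee_fin ler_norml; lra.
have d0 : (0 <= diam (supp mu))%E.
  by apply: ereal_sup_ubound; exists (x0, x0) => //=; rewrite subrr normr0.
exists (fine (diam (supp mu))).
  by rewrite -lee_fin fineK// ge0_fin_numE// (le_lt_trans dc) ?ltry.
by rewrite /diam_class /= fineK// ge0_fin_numE// (le_lt_trans dc) ?ltry.
Qed.

End support.

(** * Integrals of telescoping densities over periodic sets *)

Section telescoping.
Context {R : realType}.
Local Notation RR := (measurableTypeR R).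
Local Notation lambda := (@lebesgue_measure R).
Implicit Types (D B : set RR) (g : RR -> \bar R).
Local Open Scope ereal_scope.

Lemma ge0_integral_shift (d : R) D g : measurable D -> measurable_fun setT g ->
  (forall x, 0 <= g x) ->
  \int[lambda]_(x in translation d @^-1` D) g (x + d)%R = \int[lambda]_(x in D) g x.
Proof.
move=> mD mg g0.
have mt : measurable_fun setT (translation d : RR -> RR).
  exact: measurable_funD.
rewrite -(@ge0_integral_pushforward _ _ RR RR R _ mt lambda D g)//; last first.
  exact: measurable_funTS.
apply: eq_measure_integral => A mA _; exact: lebesgue_shift.
Qed.

Section telescope.
Variables (h C : R) (phi f : RR -> R).
Hypothesis h0 : (0 < h)%R.
Hypotheses (mphi : measurable_fun setT phi) (mf : measurable_fun setT f).
Hypotheses (f0 : forall x, (0 <= f x)%R) (phi0 : forall x, (0 <= phi x <= C)%R).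
Hypotheses (phi_neg : forall x, (x < 0)%R -> phi x = 0%R).
Hypotheses (phi_large : exists M, forall x, (M <= x)%R -> phi x = C).
Hypothesis phiE : forall x, phi x = (f x + phi (x - h))%R.

Let mphiE D : measurable_fun D (EFin \o phi).
Proof. by apply/measurable_EFinP; exact: measurable_funTS. Qed.
Let mfE D : measurable_fun D (EFin \o f).
Proof. by apply/measurable_EFinP; exact: measurable_funTS. Qed.
Let phiE0 x : 0 <= (phi x)%:E.
Proof. by rewrite lee_fin; case/andP : (phi0 x). Qed.

(* [f] telescopes: its mass below [N h] is that of [phi] between [(N - 1) h] and
   [N h]. *)
Lemma integral_telescope B : measurable B -> (forall x, B (x + h)%R = B x) ->
  \int[lambda]_(x in B) (f x)%:E = C%:E * lambda (B `&` `[0%R, h[).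
Proof.
move=> mB Bh; have [M phiM] := phi_large.
pose n := (Num.truncn (`|M| / h)).+1.
have Mn : (M <= n%:R * h)%R.
  rewrite -ler_pdivrMr// (le_trans _ (ltW (truncnS_gt _)))//.
  by rewrite ler_pM2r ?invr_gt0// ler_norm.
clearbody n; have nh0 : (0 <= n%:R * h)%R by rewrite mulr_ge0// ltW.
have nhS : (n%:R * h <= n.+1%:R * h)%R by rewrite ler_pM2r// ler_nat.
pose E (k : nat) : set RR := B `&` `]-oo, (k%:R * h)%R[.
have mE k : measurable (E k) by exact: measurableI.
have Jstep : \int[lambda]_(x in E n.+1) (phi x)%:E =
    \int[lambda]_(x in E n.+1) (f x)%:E + \int[lambda]_(x in E n) (phi x)%:E.
  under eq_integral do rewrite phiE EFinD.
  rewrite ge0_integralD//; last 2 first.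
  - by move=> x _; rewrite lee_fin.
  - apply/measurable_EFinP; apply: measurable_funTS.
    by apply: measurableT_comp => //; exact: measurable_funB.
  congr (_ + _); rewrite -(@ge0_integral_shift (- h)%R (E n) (EFin \o phi))//.
  congr (\int[lambda]_(x in _) _); apply/seteqP; split => x.
    rewrite /E /translation /= !in_itv/= -natr1 mulrDl mul1r => -[Bx xn].
    by rewrite -(Bh (x - h)%R) subrK; split=> //; rewrite ltrBlDr.
  rewrite /E /translation /= !in_itv/= -natr1 mulrDl mul1r => -[Bx xn].
  by rewrite -(subrK h x) Bh; split=> //; rewrite subrK -ltrBlDr.
(* The same integral, cut at n h, beyond which [phi] equals [C]. *)
have Jsplit : \int[lambda]_(x in E n.+1) (phi x)%:E =
    C%:E * lambda (B `&` `[0%R, h[) + \int[lambda]_(x in E n) (phi x)%:E.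
  have -> : E n.+1 = (B `&` `[(n%:R * h)%R, (n.+1%:R * h)%R[) `|` E n.
    rewrite /E -setIUr; congr (_ `&` _); apply/seteqP; split => x /=.
      rewrite !in_itv/= => xn; have [_|_] := ltP x (n%:R * h)%R; first by right.
      by left.
    by rewrite !in_itv/= => -[/andP[]//|/lt_le_trans]; exact.
  rewrite ge0_integral_setU//; last 2 first.
    exact: measurableI.
  - rewrite disj_set2E; apply/eqP/seteqP; split => // x [[_ /=] + [_ /=]].
    by rewrite !in_itv/= => /andP[nx _]; rewrite ltNge nx.
  congr (_ + _).
  rewrite (eq_integral (cst C%:E)) => [|x]; last first.
    rewrite inE => -[_] /=; rewrite in_itv/= => /andP[nx _].
    by rewrite phiM// (le_trans Mn).
  rewrite integral_cst; last exact: measurableI.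
  congr (_ * _); rewrite -[LHS](@lebesgue_shift R (n%:R * h)%R); last exact: measurableI.
  have Bn (k : nat) (x : R) : B (x + k%:R * h)%R = B x.
    elim: k => [|k ih]; first by rewrite mul0r addr0.
    by rewrite -natr1 mulrDl mul1r addrA Bh.
  congr (lambda _); apply/seteqP; split => x /=; rewrite /translation Bn !in_itv/=
    -natr1 mulrDl mul1r => -[Bx] /andP[? ?]; split=> //; apply/andP; split; lra.
(* Finiteness allows the cancellation of this term between [Jstep] and [Jsplit]. *)
have Jfin : \int[lambda]_(x in E n) (phi x)%:E \is a fin_num.
  rewrite ge0_fin_numE ?integral_ge0//.
  have -> : E n = (B `&` `]-oo, 0%R[) `|` (B `&` `[0%R, (n%:R * h)%R[).
    rewrite /E -setIUr; congr (_ `&` _); apply/seteqP; split => x /=.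
      by rewrite !in_itv/= => xn; have [_|_] := ltP x 0%R; [left|right].
    by rewrite !in_itv/= => -[/lt_le_trans|/andP[]//]; exact.
  rewrite ge0_integral_setU//; last 3 first.
    exact: measurableI.
    exact: measurableI.
  - rewrite disj_set2E; apply/eqP/seteqP; split => // x [[_ /=] + [_ /=]].
    by rewrite !in_itv/= ltNge => /negP nx /andP[].
  rewrite integral0_eq ?add0e; last first.
    by move=> x [_] /=; rewrite in_itv/= => /phi_neg ->.
  apply: (@le_lt_trans _ _ (\int[lambda]_(x in `[0%R, (n%:R * h)%R[) C%:E)).
    apply: (@le_trans _ _ (\int[lambda]_(x in `[0%R, (n%:R * h)%R[) (phi x)%:E)).
      by apply: ge0_subset_integral => //; exact: measurableI.
    apply: ge0_le_integral => //.
    by move=> x _; rewrite lee_fin; case/andP : (phi0 x).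
  rewrite integral_cst//= lebesgue_measure_itv/=.
  by case: ifP => _; rewrite ?mule0// -EFinB -EFinM ltry.
(* Beyond (n + 1) h both [phi x] and [phi (x - h)] equal [C], so [f] vanishes. *)
have -> : \int[lambda]_(x in B) (f x)%:E = \int[lambda]_(x in E n.+1) (f x)%:E.
  have {1}-> : B = E n.+1 `|` (B `&` `[(n.+1%:R * h)%R, +oo[).
    rewrite /E -setIUr -[LHS]setIT; congr (_ `&` _); apply/seteqP; split => x //= _.
    by rewrite !in_itv/= andbT; have [_|_] := ltP x (n.+1%:R * h)%R; [left|right].
  rewrite ge0_integral_setU//; last 3 first.
  - exact: measurableI.
  - by move=> x _; rewrite lee_fin.
  - rewrite disj_set2E; apply/eqP/seteqP; split => // x [[_ /=] + [_ /=]].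
    by rewrite !in_itv/= andbT leNgt => ->.
  rewrite [X in _ + X]integral0_eq ?adde0// => x [_] /=; rewrite in_itv/= andbT => nx.
  congr EFin; have := phiE x; rewrite !phiM; first by lra.
    by move: nx; rewrite -natr1; lra.
  by rewrite (le_trans Mn)// (le_trans nhS).
have := addeK (\int[lambda]_(x in E n.+1) (f x)%:E) Jfin; rewrite -Jstep Jsplit addeK// => ->.
Qed.

End telescope.
End telescoping.

(** * The law mu_beta for positive beta *)

Section mu_beta.
Context {R : realType}.
Local Notation RR := (measurableTypeR R).
Local Notation lambda := (@lebesgue_measure R).
Variables (beta : R) (b0 : 0 < beta).

Let a0 : 0 < beta^-1. Proof. by rewrite invr_gt0. Qed.
Let bV : beta * beta^-1 = 1. Proof. by rewrite mulfV// gt_eqF. Qed.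

(** The function to be telescoped: its difference of step 1 for b = 1 / beta, and of step 1 / beta
    for b = 1, is the density. *)
Definition clipped_cell b t : R := beta * clip b (cell_end beta t).

Lemma clipped_cell_measurable b :
  measurable_fun setT (clipped_cell b : RR -> RR).
Proof.
apply: nondecreasing_measurable => // x y xy; rewrite ler_pM2l// /clip.
by rewrite le_max2// le_min2// cell_end_nondecreasing.
Qed.

Lemma clipped_cell_bound b t : 0 <= b -> 0 <= clipped_cell b t <= beta * b.
Proof.
move=> bb; rewrite /clipped_cell /clip mulr_ge0 ?(ltW b0) ?le_max ?lexx//=.
by rewrite ler_pM2l// ge_max bb ge_min lexx orbT.
Qed.

Lemma clipped_cell_neg b t : 0 <= b -> t < 0 -> clipped_cell b t = 0.
Proof.
move=> bb t0; rewrite /clipped_cell /clip max_l ?mulr0//.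
by rewrite ge_min cell_end_le0.
Qed.

Lemma clipped_cell_large b t : 0 <= b -> b <= t -> clipped_cell b t = beta * b.
Proof.
move=> bb bt; rewrite /clipped_cell /clip min_r ?max_r//.
exact: le_trans (cell_end_ge _ _).
Qed.

Lemma rho_clipped1 t :
  clipped_cell beta^-1 t = rho beta t + clipped_cell beta^-1 (t - 1).
Proof.
by rewrite rhoE// trapezoidC// /clipped_cell cell_endB1//; ring.
Qed.

Lemma rho_clippedV t :
  clipped_cell 1 t = rho beta t + clipped_cell 1 (t - beta^-1).
Proof.
by rewrite rhoE// /trapezoid /clipped_cell cell_endBV//; ring.
Qed.

Lemma rho_ge0 t : 0 <= rho beta t.
Proof.
rewrite rhoE// /trapezoid mulr_ge0 ?(ltW b0)// subr_ge0 /clip.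
by rewrite le_max2// le_min2// gerBl ltW.
Qed.

Lemma rho_measurable : measurable_fun setT (rho beta : RR -> RR).
Proof.
rewrite (_ : rho beta = (fun t => clipped_cell 1 t - clipped_cell 1 (t - beta^-1))).
  apply: measurable_funB; first exact: clipped_cell_measurable.
  apply: measurableT_comp; first exact: clipped_cell_measurable.
  exact: measurable_funB.
by apply/funext => t; rewrite rho_clippedV addrK.
Qed.

Lemma mu_periodic1 (B : set RR) : measurable B -> (forall x, B (x + 1) = B x) ->
  mu_ beta B = lambda (B `&` `[0, 1[).
Proof.
move=> mB B1; rewrite /mu_ -[RHS]mul1e -[X in (X%:E * _)%E]bV.
apply: (@integral_telescope R 1 (beta * beta^-1) (clipped_cell beta^-1)) => //.
- exact: clipped_cell_measurable.
- exact: rho_measurable.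
- exact: rho_ge0.
- by move=> x; exact/clipped_cell_bound/ltW.
- by move=> x; apply: clipped_cell_neg; exact: ltW.
- by exists beta^-1 => x; apply: clipped_cell_large; exact: ltW.
- exact: rho_clipped1.
Qed.

Lemma mu_periodicV (B : set RR) : measurable B -> (forall x, B (x + beta^-1) = B x) ->
  mu_ beta B = (beta%:E * lambda (B `&` `[0%R, (beta^-1)%R[))%E.
Proof.
move=> mB Ba; rewrite /mu_ -[X in (X%:E * _)%E]mulr1.
apply: (@integral_telescope R beta^-1 (beta * 1) (clipped_cell 1)) => //.
- exact: clipped_cell_measurable.
- exact: rho_measurable.
- exact: rho_ge0.
- by move=> x; exact: clipped_cell_bound.
- by move=> x; exact: clipped_cell_neg.
- by exists 1 => x; exact: clipped_cell_large.
- exact: rho_clippedV.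
Qed.

Lemma mu_probability : exists mu : probability RR R, forall A, mu A = mu_ beta A.
Proof.
have m0 : mu_ beta set0 = 0%E by rewrite /mu_ integral_set0.
have mge0 A : (0 <= mu_ beta A)%E.
  by apply: integral_ge0 => x _; rewrite lee_fin rho_ge0.
have msa : semi_sigma_additive (mu_ beta).
  apply: semi_sigma_additive_nng_induced; last by move=> x; rewrite lee_fin rho_ge0.
  by apply/measurable_EFinP; exact: rho_measurable.
have mT : mu_ beta setT = 1%E.
  rewrite mu_periodic1// setTI lebesgue_measure_itv/= lte_fin ltr01.
  by rewrite oppr0 adde0.
pose mM := isMeasure.Build _ _ _ (mu_ beta) m0 mge0 msa.
pose m : {measure set RR -> \bar R} := HB.pack (mu_ beta) mM.
pose mP := Measure_isProbability.Build _ _ _ m mT.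
pose P : probability RR R := HB.pack (mu_ beta) mM mP.
by exists P.
Qed.

Lemma mu_CIUPM (mu : probability RR R) : (forall A, mu A = mu_ beta A) ->
  CIUPM (affine 0 beta) mu.
Proof.
move=> muE; split => A mA.
  rewrite [LHS]muE mu_periodic1 ?lambda_circle_fracpart//.
    exact: fracpart_preimage_measurable.
  exact: fracpart_periodic.
rewrite [LHS]muE mu_periodicV; last 2 first.
- apply: measurable_preimageT; last exact: fracpart_preimage_measurable.
  by apply: affine_measurable; exact: ltW.
- move=> x; rewrite /preimage /affine /= !addr0 mulrDr bV.
  by rewrite -[1]/(1%:~R) fracpartDz.
have mfA := fracpart_preimage_measurable mA.
rewrite -lambda_circle_fracpart [RHS](@lebesgue_affine R 0 beta)//; last exact: measurableI.
congr (_ * lambda _)%E; apply/seteqP.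
by split => x /= [Ax] x01; split => //; move: x01;
  rewrite /affine !in_itv/= addr0 ?pmulr_rge0// -ltr_pdivlMl// mulr1.
Qed.

Lemma mu_supported (mu : probability RR R) : (forall A, mu A = mu_ beta A) ->
  mu `[0, 0 + c_ beta]%classic = 1%E.
Proof.
move=> muE; rewrite -(probability_setT mu) !muE add0r /mu_.
rewrite -[in RHS](setvU `[0, c_ beta]%classic) ge0_integral_setU//; last 4 first.
- exact: measurableC.
- by apply/measurable_EFinP; apply: measurable_funTS; exact: rho_measurable.
- by move=> x _; rewrite lee_fin rho_ge0.
- by rewrite disj_set2E setICl.
rewrite [X in (X + _)%E]integral0_eq ?add0e// => x /= xN; congr EFin.
apply: rho_eq0 => //; have [x0|x0] := ltP x 0; first by left.
right; rewrite leNgt; apply/negP => xc; apply: xN.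
by rewrite in_itv/= x0 ltW.
Qed.

End mu_beta.

(** * Mixtures, and the three claims for positive slope *)

Section main.
Context {R : realType}.
Local Notation RR := (measurableTypeR R).
Implicit Types (s c w d gamma : R) (mu nu : probability RR R).

Lemma translation_measurable gamma :
  measurable_fun setT (translation gamma : RR -> RR).
Proof. exact: measurable_funD. Qed.

Lemma translation_itv gamma s c :
  translation gamma @^-1` `[s, s + c] = `[s - gamma, s - gamma + c]%classic.
Proof.
by apply/seteqP; split => x; rewrite /translation /= !in_itv/= => /andP[? ?];
  apply/andP; split; lra.
Qed.

Lemma probability_translation mu gamma :
  exists nu, eq_meas nu (push mu (translation gamma)).
Proof.
pose mX := isMeasurableFun.Build _ _ _ _ _ (translation_measurable gamma).
pose X : {mfun RR >-> RR} := HB.pack (translation gamma : RR -> RR) mX.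
by exists (distribution mu X).
Qed.

Lemma probability_mixture mu nu w : 0 <= w <= 1 -> exists pi : probability RR R,
  forall A, pi A = (w%:E * mu A + (1 - w)%:E * nu A)%E.
Proof.
move=> /andP[w0 w1]; have w1' : 0 <= 1 - w by rewrite subr_ge0.
pose m : {measure set RR -> \bar R} :=
  measure_add (mscale (NngNum w0) mu) (mscale (NngNum w1') nu).
have mE A : m A = (w%:E * mu A + (1 - w)%:E * nu A)%E by exact: measure_addE.
have mT : m setT = 1%E.
  by rewrite mE !probability_setT !mule1 -EFinD addrC subrK.
pose mP := Measure_isProbability.Build _ _ _ m mT.
pose P : probability RR R := HB.pack (Measure.sort m) mP.
by exists P.
Qed.

Lemma mixture_eq1 mu nu w A : 0 < w < 1 -> measurable A ->
  (w%:E * mu A + (1 - w)%:E * nu A = 1)%E -> mu A = 1%E /\ nu A = 1%E.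
Proof.
move=> /andP[w0 w1] mA.
have := probability_le1 mu mA; have := probability_le1 nu mA.
rewrite -[mu A]fineK ?fin_num_measure// -[nu A]fineK ?fin_num_measure//.
move: (fine (mu A)) (fine (nu A)) => x y; rewrite !lee_fin -!EFinM -EFinD.
move=> y1 x1 [E].
have {}x1 : 0 <= w * (1 - x) by rewrite mulr_ge0//; lra.
have {}y1 : 0 <= (1 - w) * (1 - y) by rewrite mulr_ge0//; lra.
split; congr EFin; apply/eqP; rewrite eq_sym -subr_eq0.
  have : w * (1 - x) == 0 by apply/eqP; lra.
  by rewrite mulf_eq0 gt_eqF.
have : (1 - w) * (1 - y) == 0 by apply/eqP; lra.
by rewrite mulf_eq0 gt_eqF// subr_gt0.
Qed.

Lemma diam_class_le mu s c d : diam_class d mu ->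
  mu `[s, s + c]%classic = 1%E -> d <= c.
Proof.
move=> dd /diam_supp_le[e ec ed].
by have [->] : d%:E = e%:E by rewrite -dd -ed.
Qed.

Section positive.
Variables (beta : R) (b0 : 0 < beta).
Local Notation U := (CIUPM (affine 0 beta)).
Local Notation c0 := (c_ beta).

Let bN0 : beta != 0. Proof. by rewrite gt_eqF. Qed.

(** The diameter is at most [c0], and [CIUPM_length] excludes a smaller one. *)
Lemma diam_class_CIUPM mu s : U mu -> mu `[s, s + c0]%classic = 1%E ->
  diam_class c0 mu.
Proof.
move=> muU /diam_supp_le[d dc dmu].
have [r rd] := diam_classP dmu.
by have -> : c0 = d by apply/eqP; rewrite eq_le dc (CIUPM_length b0 muU rd).
Qed.

Lemma CIUPM_mixture mu nu (pi : probability RR R) w : 0 <= w <= 1 ->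
  (forall A, pi A = (w%:E * mu A + (1 - w)%:E * nu A)%E) -> U mu -> U nu -> U pi.
Proof.
move=> /andP[w0 w1] piE [mu1 mub] [nu1 nub].
have mix x : (w%:E * x + (1 - w)%:E * x = x)%E.
  by rewrite -ge0_muleDl ?lee_fin ?subr_ge0// -EFinD addrC subrK mul1e.
split => A mA; rewrite [LHS]piE.
  have -> : mu (fracpart @^-1` A) = lambda_circle A by exact: mu1.
  by have -> : nu (fracpart @^-1` A) = lambda_circle A by exact: nu1.
have -> : mu (affine 0 beta @^-1` (fracpart @^-1` A)) = lambda_circle A by exact: mub.
by have -> : nu (affine 0 beta @^-1` (fracpart @^-1` A)) = lambda_circle A by exact: nub.
Qed.

(** If d > 0, the law would be carried by the overlap of two intervals, which is shorter than
    [c0]. *)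
Lemma mu_gap mu d : (forall A, mu A = mu_ beta A) ->
  mu `[- d, - d + c0]%classic = 1%E -> d <= 0.
Proof.
move=> muE mud; rewrite leNgt; apply/negP => d0.
have := full_itvI (mu_supported b0 muE) mud.
move=> /(CIUPM_length b0 (mu_CIUPM b0 muE)).
rewrite max_l; last lra.
by rewrite min_r; lra.
Qed.

Section stretched.
Variables (mu nu : probability RR R) (c : R).
Hypotheses (muE : forall A, mu A = mu_ beta A) (cc : c0 <= c)
  (nuE : eq_meas nu (push mu (translation (c - c0)))).

Let muU : U mu. Proof. exact: mu_CIUPM. Qed.
Let nuU : U nu. Proof. exact: CIUPM_translation nuE muU. Qed.
Let mu1 : mu `[0, 0 + c0]%classic = 1%E. Proof. exact: mu_supported. Qed.

Lemma nu_itv s d : nu `[s, s + d]%classic = mu `[s - (c - c0), s - (c - c0) + d]%classic.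
Proof. by rewrite nuE// /push /pushforward translation_itv. Qed.

Lemma stretched_mixture w : 0 < w < 1 ->
  exists pi : probability RR R, [/\ forall A, pi A = (w%:E * mu A + (1 - w)%:E * nu A)%E,
    U pi, pi `[0, 0 + c]%classic = 1%E & diam_class c pi].
Proof.
have c0c := cc; move=> w01; have /andP[w0 w1] := w01.
have [|pi piE] := @probability_mixture mu nu w; first by rewrite !ltW.
have piU : U pi by apply: CIUPM_mixture piE muU nuU; rewrite !ltW.
have pi1 : pi `[0, 0 + c]%classic = 1%E.
  have widen s' c' : s' <= 0 -> c0 <= s' + c' -> mu `[s', s' + c']%classic = 1%E.
    by move=> s0 cs; apply: full_itv_widen mu1; rewrite ?add0r.
  rewrite piE nu_itv !widen; [|lra|lra|lra|lra].
  by rewrite !mule1 -EFinD addrC subrK.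
exists pi; split => //.
have [d dc dpi] := diam_supp_le pi1.
have [s sd] := diam_classP dpi.
have [mus] : mu `[s, s + d]%classic = 1%E /\ nu `[s, s + d]%classic = 1%E.
  by apply: (mixture_eq1 w01) => //; rewrite -piE.
rewrite nu_itv => nus.
(* Full mass of [nu] on [s, s + d] is full mass of [mu] on that interval moved left by c - c0. The
   overlap, of length d - (c - c0), is at least [c0] long, so c <= d. *)
have := full_itvI mus nus => /(CIUPM_length b0 muU).
rewrite max_l; last lra.
rewrite min_r; last lra.
move=> cd; suff -> : c = d by [].
by lra.
Qed.

End stretched.

Lemma CIUPM_diam_class_nonempty c : 
  (U `&` diam_class c !=set0) <-> c0 <= c.
Proof.
have [mu muE] := mu_probability b0.
split=> [[nu [nuU /diam_classP[s sc]]]|cc]; first exact: CIUPM_length nuU sc.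
have [nu nuE] := probability_translation mu (c - c0).
have [|pi [_ piU _ pid]] := stretched_mixture muE cc nuE (w := 2^-1).
  by apply/andP; split; lra.
by exists pi.
Qed.

Lemma CIUPM_minimal_diam : U `&` diam_class c0 = translates (mu_ beta).
Proof.
have [mu muE] := mu_probability b0.
have muU := mu_CIUPM b0 muE; have mu1 := mu_supported b0 muE.
apply/seteqP; split => nu.
  move=> [nuU /diam_classP[s sc]]; exists s.
  have [nu' nu'E] := probability_translation mu s.
  suff nunu' : eq_meas nu nu' by move=> A mA; rewrite nunu'// nu'E// /push /pushforward muE.
  apply: cdf_unique => t.
  have := CIUPM_unique b0 nuU muU sc mu1 (t - s).
  have -> : s + (t - s) = t by ring.
  rewrite add0r => ->; rewrite nu'E//; congr (mu _); apply/seteqP.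
  by split => x; rewrite /translation /= !in_itv/= lerBrDr.
move=> [gamma nuE].
have nuE' : eq_meas nu (push mu (translation gamma)).
  by move=> A mA; rewrite nuE// /push /pushforward muE.
have nuU : U nu by exact: CIUPM_translation nuE' muU.
split => //; apply: (diam_class_CIUPM (s := gamma)) => //.
by rewrite nuE'// /push /pushforward translation_itv subrr.
Qed.

(** The mixtures with weights 1 / 3 and 2 / 3 cannot both be translates of [mu]. *)
Lemma CIUPM_large_diam c mu : c0 < c -> (U `&` diam_class c) mu ->
  U `&` diam_class c <> translates mu.
Proof.
move=> cc [muU mud] UE.
have [m mE] := mu_probability b0.
have [m' m'E] := probability_translation m (c - c0).
have [] := @stretched_mixture m m' c mE (ltW cc) m'E 3^-1.
  by apply/andP; split; lra.
move=> pi [piE piU pi1 pid].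
have [] := @stretched_mixture m m' c mE (ltW cc) m'E (1 - 3^-1).
  by apply/andP; split; lra.
move=> rho [rhoE rhoU rho1 rhod].
have : (U `&` diam_class c) pi by [].
rewrite UE => -[g gE].
have : (U `&` diam_class c) rho by [].
rewrite UE => -[g' g'E].
have mug : mu `[0 - g, 0 - g + c]%classic = 1%E.
  by rewrite -pi1 gE// /push /pushforward translation_itv.
have mug' : mu `[0 - g', 0 - g' + c]%classic = 1%E.
  by rewrite -rho1 g'E// /push /pushforward translation_itv.
(* Here [mu] is carried by two intervals of length [c]; its diameter is [c], so they coincide. *)
have gg' : g = g'.
  have := diam_class_le mud (full_itvI mug mug').
  rewrite /Num.max /Num.min.
  by do ![case: ifPn; rewrite -?leNgt]; lra.
have pirho A : measurable A -> pi A = rho A by move=> mA; rewrite gE// gg' -g'E.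
have m1 := mu_supported b0 mE.
(* With x the mass given by [m'] to [0, c0], equality reads 1 / 3 + 2 x / 3 = 2 / 3 + x / 3, so x =
   1, against [mu_gap]. *)
have := pirho `[0, 0 + c0]%classic (measurable_itv _).
rewrite piE rhoE m1 m'E// /push /pushforward translation_itv.
rewrite sub0r !mule1.
have gap := @mu_gap m (c - c0) mE.
have [x xE] : exists x, m `[- (c - c0), - (c - c0) + c0]%classic = x%:E.
  by exists (fine (m `[- (c - c0), - (c - c0) + c0]%classic)); rewrite fineK ?fin_num_measure.
rewrite xE -!EFinM -!EFinD => -[E].
have : c - c0 <= 0 by apply: gap; rewrite xE; congr EFin; lra.
by lra.
Qed.

End positive.
End main.

(** * Dependence on the absolute value of beta only *)

Section absolute_value.
Context {R : realType}.
Implicit Types beta : R.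

Lemma rational_norm beta : rational `|beta| = rational beta.
Proof.
have ratN (x : R) : rational x -> rational (- x).
  by move=> [r _ <-]; exists (- r) => //; rewrite raddfN.
apply/propext; case: (ler0P beta) => // _; split => /ratN//; by rewrite opprK.
Qed.

Lemma pq_norm beta : pq `|beta| = pq beta.
Proof. by rewrite /pq normr_id. Qed.

Lemma c_norm beta : c_ `|beta| = c_ beta.
Proof. by rewrite /c_ rational_norm normr_id /p_ pq_norm. Qed.

Lemma mu_norm beta : mu_ `|beta| = mu_ beta.
Proof.
rewrite /mu_; apply/funext => A; congr (integral _ _ _); apply/funext => t.
congr EFin; rewrite /rho [`|beta| < 0]ltNge normr_ge0/=.
by case: ltP => [b0|b0]; [rewrite ltr0_norm | rewrite ger0_norm].
Qed.

End absolute_value.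

Theorem theorem3p3 (R : realType) (alpha beta : R) (hbeta : beta != 0) :
  [/\ forall c : R, 0 <= c ->
        (CIUPM (affine alpha beta) `&` diam_class c !=set0) <-> c_ beta <= c,
      CIUPM (affine alpha beta) `&` diam_class (c_ beta) = translates (mu_ beta) &
      forall (c : R) (mu : probability (measurableTypeR R) R),
        c_ beta < c -> (CIUPM (affine alpha beta) `&` diam_class c) mu ->
        CIUPM (affine alpha beta) `&` diam_class c <> translates mu].
Proof.
have b0 : 0 < `|beta| by rewrite normr_gt0.
rewrite (CIUPM_affine alpha hbeta) -c_norm -mu_norm; split.
- by move=> c _; exact: CIUPM_diam_class_nonempty.
- exact: CIUPM_minimal_diam.
- exact: CIUPM_large_diam.
Qed.
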